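(* Let $n\geq 1$ and let $g_1,\ldots,g_n$ be measurable functions on $\mathbb R$ such that $0\leq g_j\leq 1$ and $\int_{\mathbb R} g_j(x)\,dx=1$ for all $1\leq j\leq n$. Then, for all non-negative measurable functions $h$ on $\mathbb R$, $$\int_{\mathbb R} h(x)\,(g_1*\cdots*g_n)(x)\,dx\leq\int_{\mathbb R} h^*(x)\,M_n(x)\,dx.$$ If equality holds for all symmetrically decreasing functions $h$, it follows that $g_1^*=\cdots=g_n^*=M_1$ almost everywhere.
   Context: A function $f:\mathbb R\to[0,\infty]$ is called symmetrically decreasing if $f(-x)=f(x)$ for all $x\in\mathbb R$ and $f(y)\leq f(x)$ for all $0<x<y$. Two measurable functions $f,g:\mathbb R\to[0,\infty]$ are equimeasurable if the level sets $\{f>\lambda\}$ and $\{g>\lambda\}$ have the same Lebesgue measure for every $\lambda\geq 0$. The symmetric decreasing rearrangement $f^*$ of a non-negative measurable function $f$ is the symmetrically decreasing function equimeasurable with $f$; it is uniquely determined up to equality almost everywhere. The convolution is $(f*g)(x)=\int_{\mathbb R} f(x-y)g(y)\,dy$; for $n=1$, $g_1*\cdots*g_n$ means $g_1$. The functions $M_n$ (centered cardinal B-splines) are defined by $M_1=\mathbf 1_{(-1/2,1/2)}$, the indicator function of $(-1/2,1/2)$, and $M_n=M_{n-1}*M_1$ for $n\geq 2$. *)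

(* Defs.v *)
From mathcomp Require Export all_boot all_order all_algebra.
From mathcomp Require Export all_classical all_reals all_analysis.
From mathcomp Require Export measurable_realfun.

Set Implicit Arguments.
Unset Strict Implicit.
Unset Printing Implicit Defensive.

Import Order.TTheory GRing.Theory Num.Theory.
Import numFieldNormedType.Exports.

Local Open Scope classical_set_scope.
Local Open Scope ring_scope.
Local Open Scope ereal_scope.

(* [R] with the sigma-algebra of Lebesgue measurable sets (Borel sets up to
   null sets, see [completed_caratheodory_measurable]); the library's default
   structure on [R] has only the Borel sets. *)
Notation lebesgueType R := (caratheodory_type ((wlength (R := R) idfun)^*)%mu).

Notation lebesgue := (@completed_lebesgue_measure _).

Definition lebesgue_measurable (R : realType) d (U : measurableType d)
    (f : R -> U) :=
  measurable_fun [set: lebesgueType R] (f : lebesgueType R -> U).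

Section rearrangement.
Context {R : realType}.
Implicit Types f g : R -> \bar R.

Definition symmetrically_decreasing f :=
  [/\ forall x, 0 <= f x,
      forall x, f (- x)%R = f x &
      forall x y, (0 < x)%R -> (x < y)%R -> f y <= f x].

Definition equimeasurable f g :=
  [/\ lebesgue_measurable f,
      lebesgue_measurable g &
      forall l : R, (0 <= l)%R ->
        lebesgue [set x | l%:E < f x] = lebesgue [set x | l%:E < g x]].

(* The definite description of [f^*] by choice: for a non-negative Lebesgue
   measurable [f] such a function exists, and it is unique up to null sets, so
   that no integral or almost everywhere statement depends on the choice. *)
Definition rearrangement f : R -> \bar R :=
  get [set fs | symmetrically_decreasing fs /\ equimeasurable f fs].

End rearrangement.

Section convolution.
Context {R : realType}.
Implicit Types f g : R -> \bar R.

Definition convolution f g : R -> \bar R :=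
  fun x => \int[lebesgue]_y (f (x - y)%R * g y).

(* [g_1 * ... * g_n], bracketed to the left; the value on [::] is junk. *)
Definition convolutions (s : seq (R -> \bar R)) : R -> \bar R :=
  if s is g :: s' then foldl convolution g s' else cst 0.

End convolution.

Definition unit_box {R : realType} : R -> \bar R :=
  EFin \o \1_(`](- (1 / 2))%R, (1 / 2)%R[ : set R).

(* The centered cardinal B-splines, numbered from 1; the value at 0 is junk. *)
Fixpoint bspline {R : realType} (n : nat) : R -> \bar R :=
  match n with
  | 0 => cst 0
  | 1 => unit_box
  | m.+1 => convolution (bspline m) unit_box
  end.

(* Main.v *)
Require Import Defs.
From mathcomp Require Import ring lra.

(** A bound on [\int w (G * g)], for densities [w] and [g] with values in [0, 1]
    and [g] of mass 1, is obtained from a bound on the integrals of [G] alone.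
    Say that [G] is majorized by [M] when [\int v G] is at most the integral of
    [M] over the centered interval of length [\int v], for every density [v]
    with values in [0, 1].  The inequality of the theorem follows from the fact
    that [g_1 * ... * g_n] is majorized by the B-spline of order [n], by slicing
    [h] and its rearrangement into superlevel sets ([majorized_level],
    [layer_cake], [majorized_rearrangement]).

    Majorization is proved by induction on [n], and the inductive step
    ([pairing_le_box], [majorized_convolution]) rests on the following picture.
    In [\int \int w(x) g(z) G(x - z)], parametrize [x] by the mass [k] of [w] to
    its left and [z] by the mass of [g] to its left.  The parameter rectangle is
    then foliated by the hooks consisting of the points whose smaller coordinate
    is [k].  Along the hook with corner [(x_k, z_k)], the integral splits into
    an arm where [x = x_k] and [z > z_k], on which [x - z < x_k - z_k], and an
    arm where [z = z_k] and [x > x_k], on which [x - z > x_k - z_k].  The two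
    arms therefore use disjoint sets of values [y = x - z], and together they
    integrate [G] against one density [v(y)] with values in [0, 1] and of mass
    [\int w + \int g - 2 k], to which the majorization of [G] applies
    ([hook_le]).  When [w] and [g] are indicators of centered intervals and [G]
    is replaced by [M], the hooks give exactly the central masses of [M]; so the
    pair of centered intervals is extremal.  Instead of the foliation itself,
    the proof peels off hooks of a small width [e], with an error of order
    [e ^+ 2] for each of them ([hook_step], [box_hook_step], [hook_iter]).

    For the case of equality a single test function suffices, the indicator of
    [(- n / 2, n / 2)]: equality for it means that [g_1 * ... * g_n] lives on an
    interval of length [n].  Lengths of essential supports add up under
    convolution ([concentrated_convolution]), and each [g_j], being at most 1
    with integral 1, needs a length of at least 1.  So every [g_j] lives on an
    interval of length 1, where it must be equal to 1 almost everywhere.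

    Tonelli's theorem needs joint measurability of [f (x - y)], which a Lebesgue
    measurable [f] does not provide for the product of two copies of the Lebesgue
    sigma-algebra.  For that reason all functions are first replaced by Borel
    functions that agree with them almost everywhere ([borel_version]); this
    does not change any value of a convolution ([eq_convolution_ae]). *)

Set Implicit Arguments.
Unset Strict Implicit.
Unset Printing Implicit Defensive.

Import Order.TTheory GRing.Theory Num.Theory.
Import numFieldNormedType.Exports.

Local Open Scope classical_set_scope.
Local Open Scope ring_scope.
Local Open Scope ereal_scope.

(** * Integrals of nonnegative Borel functions *)

Notation mu := (@lebesgue_measure _).

Section borel_integrals.
Context {R : realType}.
Implicit Types (f g : R -> \bar R) (c k : R).

Definition nnborel f := measurable_fun [set: R] f /\ forall x, 0 <= f x.

(** The boolean chooses between translation and reflection, which are the two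
    changes of variable in convolutions. *)
Lemma nnborel_affine_comp f c (b : bool) :
  nnborel f -> nnborel (fun x => f (c + (if b then - x else x))%R).
Proof.
move=> [mf f0]; split=> //; apply: (measurableT_comp mf).
by apply: measurable_funD => //; case: b => //; exact: measurable_funN.
Qed.

Lemma nnborelD f g : nnborel f -> nnborel g -> nnborel (fun x => f x + g x).
Proof.
move=> [mf f0] [mg g0]; split; first exact: emeasurable_funD.
by move=> x; exact: adde_ge0.
Qed.

Lemma nnborelM f g : nnborel f -> nnborel g -> nnborel (fun x => f x * g x).
Proof.
move=> [mf f0] [mg g0]; split; first exact: emeasurable_funM.
by move=> x; exact: mule_ge0.
Qed.

Lemma nnborel_indic (A : set R) : measurable A -> nnborel (EFin \o \1_A).
Proof.
by move=> mA; split=> [|x /=]; [exact/measurable_EFinP|rewrite lee_fin].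
Qed.

Lemma integral_nnborelD f g : nnborel f -> nnborel g ->
  \int[mu]_x (f x + g x) = \int[mu]_x f x + \int[mu]_x g x.
Proof. by move=> [mf f0] [mg g0]; rewrite ge0_integralD. Qed.

Lemma le_integral_nnborel f g : nnborel f -> nnborel g ->
  (forall x, f x <= g x) -> \int[mu]_x f x <= \int[mu]_x g x.
Proof.
by move=> [mf f0] [mg g0] fg; apply: ge0_le_integral => // x _; exact: fg.
Qed.

(** The image of the Lebesgue measure under a translation gives every half-open
    interval its length, and a measure is determined by these values. *)
Lemma integral_shift f c : nnborel f ->
  \int[mu]_x f (c + x)%R = \int[mu]_x f x.
Proof.
move=> [mf f0].
have mc : measurable_fun [set: measurableTypeR R]
    ((fun x => c + x)%R : measurableTypeR R -> measurableTypeR R).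
  exact: measurable_funD.
have := @ge0_integral_pushforward _ _ (measurableTypeR R) (measurableTypeR R) R
  _ mc mu setT f measurableT mf (fun x _ => f0 x).
rewrite preimage_setT => <-.
apply: eq_measure_integral => /= A mA _; apply/esym/lebesgue_measure_unique => //.
move=> _ [[a b]] _ <-.
rewrite [X in _ = mu X](_ : _ = `]a - c, b - c]%classic)%R; last first.
  by apply/seteqP; split=> x /=; rewrite !in_itv/=; lra.
rewrite !lebesgue_measure_itv/= !lte_fin ltrBlDr subrK.
by case: ifPn => // _; rewrite -!EFinD; congr EFin; lra.
Qed.

Lemma integral_reflect f c : nnborel f ->
  \int[mu]_x f (c - x)%R = \int[mu]_x f x.
Proof.
move=> nf; rewrite -(integral_shift c nf).
have [mg g0] := nnborel_affine_comp c false nf.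
have mN : measurable_fun [set: measurableTypeR R]
    (-%R : measurableTypeR R -> measurableTypeR R) by exact: measurable_funN.
have := @ge0_integral_pushforward _ _ (measurableTypeR R) (measurableTypeR R) R
  _ mN mu setT _ measurableT mg (fun x _ => g0 x).
rewrite preimage_setT => <-.
by apply: eq_measure_integral => /= A mA _; exact/lebesgue_measureN.
Qed.

End borel_integrals.

Section lebesgue_borel.
Context {R : realType}.
Implicit Types (f g : R -> \bar R).

Lemma completed_borel_set (A : set R) : @measurable _ (measurableTypeR R) A ->
  @measurable _ (lebesgueType R) A /\ lebesgue A = mu A.
Proof. by move=> mA; split=> //; exact: sub_caratheodory. Qed.

Lemma lebesgue_measurable_borel f :
  measurable_fun [set: R] f -> lebesgue_measurable f.
Proof.
move=> mf _ B mB; rewrite setTI; apply: sub_caratheodory.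
by rewrite -[X in _ X]setTI; exact: mf.
Qed.

Lemma integral_lebesgue_borel f : nnborel f ->
  \int[lebesgue]_x f x = \int[mu]_x f x.
Proof.
move=> [mf f0].
have mi : measurable_fun [set: lebesgueType R]
    (idfun : lebesgueType R -> measurableTypeR R).
  by move=> _ B mB; rewrite setTI; exact: sub_caratheodory.
have := @ge0_integral_pushforward _ _ (lebesgueType R) (measurableTypeR R) R
  _ mi lebesgue setT f measurableT mf (fun x _ => f0 x).
rewrite preimage_setT => <-.
by apply: eq_measure_integral.
Qed.

End lebesgue_borel.

(** * Borel versions of Lebesgue measurable functions *)

Section borel_versions.
Context {R : realType}.
Implicit Types (f g : R -> \bar R).

Lemma null_set_lebesgue (N : set R) :
  mu.-negligible (N : set (measurableTypeR R)) ->
  lebesgue.-negligible (N : set (lebesgueType R)).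
Proof.
by move=> [M [mM M0 NM]]; exists M; split=> //; exact: sub_caratheodory.
Qed.

(** For each rational [q], the set where [f > q] is Borel up to a Borel null set.
    Setting [f] to zero on the union of these countably many null sets makes every
    superlevel set Borel, and does not leave the range of [f] except for the value
    0, so that bounds on [f] are inherited. *)
Lemma borel_version f : lebesgue_measurable f -> (forall x, 0 <= f x) ->
  exists f0, [/\ nnborel f0,
    mu.-negligible [set x : measurableTypeR R | f x <> f0 x] &
    forall x, f0 x = f x \/ f0 x = 0].
Proof.
move=> mf f0.
pose q n : R := ratr (odflt 0%R (unpickle n : option rat)).
have split_level n : exists B N : set (measurableTypeR R), [/\ measurable B,
    measurable N, mu N = 0 & forall x, ~ N x -> (q n)%:E < f x <-> B x].
  have : @measurable _ (lebesgueType R) [set x | (q n)%:E < f x].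
    by rewrite -[X in measurable X]setTI; exact: emeasurable_fun_o_infty.
  rewrite -[measurable _]/((wlength idfun)^*%mu.-cara.-measurable _).
  rewrite -completed_caratheodory_measurable g_sigma_completed_algebra_genE.
  move=> -[B mB [N [M [mM M0 NM]]]] BN.
  exists B, M; split=> // x Mx.
  have /= <- := congr1 (fun A : set R => A x) BN.
  by split=> [[//|/NM]|] //; left.
have [B {}split_level] := choice split_level.
have [N {}split_level] := choice split_level.
have mB n : measurable (B n) by have [] := split_level n.
pose M := \bigcup_n N n.
have mM : measurable M.
  by apply: bigcupT_measurable => n; have [] := split_level n.
have M0 : mu.-negligible M.
  apply: negligible_bigcup => n; have [_ mN N0 _] := split_level n.
  exact/negligibleP.
have fB n x : ~ M x -> (q n)%:E < f x <-> B n x.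
  by move=> Mx; have [_ _ _] := split_level n; apply=> Nx; apply: Mx; exists n.
exists (fun x => if x \in M then 0 else f x); split; last first.
- by move=> x; case: ifP => _; [right|left].
- apply: negligibleS M0 => x /=; case: ifPn => [|_ //].
  by rewrite inE.
split=> [|x]; last by case: ifP.
apply: (measurability _ (ErealGenOInfty.measurableE R)) => // _ [_ [a ->] <-].
rewrite setTI.
rewrite (_ : _ @^-1` _ = (\bigcup_n (if (a <= q n)%R then B n `\` M else set0))
   `|` (if (a < 0)%R then M else set0)).
  apply: measurableU; last by case: ifP.
  apply: bigcupT_measurable => n; case: ifP => _; [by apply: measurableD; [exact: mB|exact: mM]|exact: measurable0].
apply/seteqP; split=> x /=; rewrite in_itv/= andbT.
- case: ifPn; rewrite ?inE ?notin_setE.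
    by move=> Mx; rewrite lte_fin => ->; right.
  move=> Mx afx; left.
  have [n an nf] : exists2 n, (a <= q n)%R & (q n)%:E < f x.
    have [b ab bf] : exists2 b, (a < b)%R & b%:E <= f x.
      case: (f x) afx => [b|_|//]; first by rewrite lte_fin; exists b.
      by exists (a + 1)%R; rewrite ?ltrDl// leey.
    have [r] := rat_in_itvoo ab; rewrite in_itv/= => /andP[ar rb].
    exists (pickle r); rewrite /q pickleK/= ?(ltW ar)//.
    by apply: lt_le_trans bf; rewrite lte_fin.
  exists n => //; rewrite an; split=> //; exact/fB.
- move=> [[n _]|].
    case: ifP => // an [Bx Mx]; rewrite memNset//.
    by apply: le_lt_trans (proj2 (fB n x Mx) Bx); rewrite lee_fin.
  by case: ifP => // a0 Mx; rewrite mem_set// lte_fin.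
Qed.

(** Here the completeness of the Lebesgue measure enters. *)
Lemma ae_lebesgue_measurable f f0 : nnborel f0 ->
  mu.-negligible [set x : measurableTypeR R | f x <> f0 x] ->
  lebesgue_measurable f.
Proof.
move=> [mf0 _] /null_set_lebesgue [N [mN N0 fN]].
apply: (ae_measurable_fun completed_lebesgue_measure_is_complete _
  (lebesgue_measurable_borel mf0)).
exists N; split=> // x /= xN; apply: fN => /= fx; apply: xN => _.
by rewrite fx.
Qed.

Lemma integral_lebesgue_ae f f0 : nnborel f0 -> (forall x, 0 <= f x) ->
  mu.-negligible [set x : measurableTypeR R | f x <> f0 x] ->
  \int[lebesgue]_x f x = \int[mu]_x f0 x.
Proof.
move=> nf0 f_ge0 ff0; have [mf0 f0_ge0] := nf0.
rewrite -(integral_lebesgue_borel nf0); apply: ge0_ae_eq_integral.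
- exact: measurableT.
- exact: ae_lebesgue_measurable ff0.
- exact: lebesgue_measurable_borel.
- by move=> x _; exact: f_ge0.
- by move=> x _; exact: f0_ge0.
- have [N [mN N0 fN]] := null_set_lebesgue ff0.
  by exists N; split=> // x /= xN; apply: fN => /= fx; exact: xN.
Qed.

Lemma null_set_reflect (N : set (measurableTypeR R)) (c : R) :
  mu.-negligible N -> mu.-negligible [set x | N (c - x)%R].
Proof.
move=> [M [mM M0 NM]].
have [mh _] := nnborel_affine_comp c true (nnborel_indic mM).
have mcM : measurable [set x : measurableTypeR R | M (c - x)%R].
  have /measurable_EFinP/(_ measurableT [set 1%R] (measurable_set1 _)) := mh.
  rewrite setTI; congr measurable; apply/seteqP; split=> x /=.
    by rewrite indicE; case: (boolP (_ \in M)) => [/set_mem//|_ /eqP]; rewrite eq_sym oner_eq0.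
  by move=> Mx; rewrite indicE mem_set.
exists [set x | M (c - x)%R]; split=> //; last by move=> x; exact: NM.
have <- : \int[mu]_x (\1_[set x | M (c - x)%R] x)%:E =
    mu [set x : measurableTypeR R | M (c - x)%R].
  by rewrite integral_indic// setIT.
transitivity (\int[mu]_x (EFin \o \1_M) (c - x)%R); first exact: eq_integral.
by rewrite (integral_reflect c (nnborel_indic mM)) integral_indic// setIT.
Qed.

(** The equality holds at every point: for fixed [x], the reflection [y |-> x - y]
    preserves null sets, so the two integrands agree for almost every [y]. *)
Lemma eq_convolution_ae f f0 g g0 : nnborel f0 -> nnborel g0 ->
  (forall x, 0 <= f x) -> (forall x, 0 <= g x) ->
  mu.-negligible [set x : measurableTypeR R | f x <> f0 x] ->
  mu.-negligible [set x : measurableTypeR R | g x <> g0 x] ->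
  convolution f g = convolution f0 g0.
Proof.
move=> nf0 ng0 f_ge0 g_ge0 ff0 gg0; apply/funext => x; rewrite /convolution.
have nfg0 : nnborel (fun y => f0 (x - y)%R * g0 y).
  by apply: nnborelM => //; exact: nnborel_affine_comp _ true _.
rewrite [RHS]integral_lebesgue_borel//; apply: integral_lebesgue_ae => //.
  by move=> y; exact: mule_ge0.
apply: negligibleS (negligibleU (null_set_reflect x ff0) gg0) => y /= fgy.
have [fy|] := pselect (f (x - y)%R = f0 (x - y)%R); last by left.
by right=> gy; apply: fgy; rewrite fy gy.
Qed.

End borel_versions.

(** * Densities with values in [0, 1] *)

Section weights.
Context {R : realType}.
Implicit Types (w g G : R -> \bar R) (a c e : R).

Definition subunit w := nnborel w /\ forall x, w x <= 1.

Definition weight w a := subunit w /\ \int[mu]_x w x = a%:E.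

Lemma weight_ge0 w a : weight w a -> (0 <= a)%R.
Proof.
by move=> [[[_ w0] _] wa]; rewrite -lee_fin -wa integral_ge0.
Qed.

Lemma subunitM w g : subunit w -> subunit g -> subunit (fun x => w x * g x).
Proof.
move=> [nw w1] [ng g1]; split; first exact: nnborelM.
move=> x; rewrite -[leRHS]mule1; apply: lee_pmul => //; [exact: nw.2|exact: ng.2].
Qed.

Lemma subunit_indic (A : set R) : measurable A -> subunit (EFin \o \1_A).
Proof.
move=> mA; split; first exact: nnborel_indic.
by move=> x /=; rewrite lee_fin indicE; case: (_ \in _).
Qed.

Lemma nnborelZ w a : (0 <= a)%R -> nnborel w -> nnborel (fun x => a%:E * w x).
Proof.
move=> a0 [mw w0]; split; first exact: measurable_funeM.
by move=> x; rewrite mule_ge0.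
Qed.

Lemma integral_nnborelZ w a : (0 <= a)%R -> nnborel w ->
  \int[mu]_x (a%:E * w x) = a%:E * \int[mu]_x w x.
Proof. by move=> a0 [mw w0]; rewrite ge0_integralZl. Qed.

Lemma integral_setC_split w (A : set R) : measurable A -> nnborel w ->
  \int[mu]_x w x =
  \int[mu]_x (w x * (\1_A x)%:E) + \int[mu]_x (w x * (\1_(~` A) x)%:E).
Proof.
move=> mA nw; have mAC := measurableC mA.
rewrite -integral_nnborelD; last 2 first.
- by apply: nnborelM => //; exact: nnborel_indic.
- by apply: nnborelM => //; exact: nnborel_indic.
apply: eq_integral => x _; rewrite !indicE in_setC.
by case: (x \in A); rewrite /= mule1 mule0 ?add0e ?adde0.
Qed.

Lemma le_weight_indic w (A : set R) a : measurable A -> weight w a ->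
  \int[mu]_x (w x * (\1_A x)%:E) <= a%:E.
Proof.
move=> mA [[nw w1] <-]; apply: le_integral_nnborel => //.
  by apply: nnborelM => //; exact: nnborel_indic.
move=> x; rewrite -[leRHS]mule1 lee_wpmul2l ?(nw.2)//.
exact: (subunit_indic mA).2.
Qed.

Lemma weight_split w a e (A : set R) : measurable A -> weight w a ->
    \int[mu]_x (w x * (\1_A x)%:E) = e%:E ->
  weight (fun x => w x * (\1_A x)%:E) e /\
  weight (fun x => w x * (\1_(~` A) x)%:E) (a - e).
Proof.
move=> mA [uw wa] wAe; have mAC := measurableC mA.
have uwA : subunit (fun x => w x * (\1_A x)%:E).
  by apply: subunitM => //; exact: subunit_indic.
have uwAC : subunit (fun x => w x * (\1_(~` A) x)%:E).
  by apply: subunitM => //; exact: subunit_indic.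
split; split=> //; move: wa; rewrite (integral_setC_split mA uw.1) wAe EFinB => <-.
by rewrite addeAC subee// add0e.
Qed.

Lemma integral_indicM w (A : set R) : measurable A ->
  \int[mu]_x (w x * (\1_A x)%:E) = \int[mu]_(x in A) w x.
Proof.
move=> mA; rewrite [RHS]integral_mkcond; apply: eq_integral => x _.
by rewrite patchE indicE; case: (x \in A); rewrite /= ?mule1 ?mule0.
Qed.

Lemma bigcup_right_rays : \bigcup_(n : nat) `](- n%:R)%R, +oo[%classic = [set: R].
Proof.
apply/seteqP; split=> // x _; exists (Num.truncn (- x)).+1 => //=.
by rewrite in_itv/= andbT ltrNl Num.Theory.truncnS_gt.
Qed.

(** Monotone convergence along an increasing sequence of sets. *)
Lemma nnborel_bigcup_gt w (A : (set R)^nat) e : nnborel w ->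
  nondecreasing_seq A -> (forall n, measurable (A n)) ->
  e%:E < \int[mu]_(x in \bigcup_n A n) w x ->
  exists n, e%:E < \int[mu]_(x in A n) w x.
Proof.
move=> [mw w0] ndA mA ew; apply: contrapT => /forallNP wAe.
have := @ge0_nondecreasing_set_cvg_integral _ (measurableTypeR R) R A w mu ndA
  mA (fun n => measurable_funS measurableT (subsetT _) mw) (fun n x _ => w0 x).
move=> wA; have : \int[mu]_(x in \bigcup_n A n) w x <= e%:E.
  rewrite -(cvg_lim _ wA)//; apply: lime_le; first by apply/cvg_ex; eexists; exact: wA.
  by apply: nearW => n; rewrite leNgt; exact/negP.
by rewrite leNgt ew.
Qed.

(** The cut point comes from the intermediate value theorem: the distribution
    function of [w] is 1-Lipschitz because [w <= 1].  The set is a half-line,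
    except for [e = 0] and [e = a], where no finite cut point need exist; what
    the hooks use is only that it lies to the left of its complement. *)
Lemma weight_cut w a e : weight w a -> (0 <= e <= a)%R ->
  exists A : set R, [/\ measurable A, forall x y, A x -> ~ A y -> (x < y)%R &
    \int[mu]_x (w x * (\1_A x)%:E) = e%:E].
Proof.
move=> [uw wa] /andP[]; have [nw w1] := uw; have [mw w0] := nw.
rewrite le_eqVlt => /predU1P[<- _|e0].
  by exists set0; split=> //; rewrite integral_indicM ?integral_set0.
rewrite le_eqVlt => /predU1P[->|ea].
  by exists setT; split=> //; rewrite integral_indicM.
have mI t : measurable (`]-oo, t] : set R) by exact: measurable_itv.
pose F t := fine (\int[mu]_(x in `]-oo, t]) w x).
have FE t : (F t)%:E = \int[mu]_(x in `]-oo, t]) w x.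
  rewrite fineK// ge0_fin_numE ?integral_ge0// -integral_indicM//.
  by rewrite (le_lt_trans (le_weight_indic (mI t) (conj uw wa)))// ltry.
have F_lip s t : (s <= t)%R -> (F s <= F t <= F s + (t - s))%R.
  move=> st; rewrite -!lee_fin EFinD !FE; apply/andP; split.
    apply: ge0_subset_integral => //; first exact: measurable_funS mw.
    by apply: subset_itvl; rewrite bnd_simp.
  have -> : (t - s)%:E = \int[mu]_x (\1_(`]s, t]%classic : set (measurableTypeR R)) x)%:E.
    rewrite integral_indic//= setIT lebesgue_measure_itv/= lte_fin -EFinB.
    by case: ltP => // ts; congr EFin; lra.
  have nwI r : nnborel (fun x => w x * (\1_(`]-oo, r]%classic : set R) x)%:E).
    by apply: nnborelM => //; exact: nnborel_indic.
  have nI : nnborel (EFin \o \1_(`]s, t]%classic : set R)).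
    exact: nnborel_indic.
  rewrite -(integral_indicM _ (mI t)) -(integral_indicM _ (mI s)).
  rewrite -(integral_nnborelD (nwI s) nI).
  apply: (le_integral_nnborel (nwI t) (nnborelD (nwI s) nI)).
  move=> x /=; rewrite !indicE !mem_setE !in_itv/=.
  case: (leP x t) => xt; last by rewrite andbF mule0 adde_ge0 ?mule_ge0 ?lee_fin.
  rewrite andbT; case: (leP x s) => xs.
    by rewrite adde0.
  by rewrite mule0 add0e mule1.
have Fc : continuous F.
  move=> t; apply/cvgrPdist_le => d d0; near=> s.
  have : (`|t - s| <= d)%R.
    by near: s; by apply: cvgr_dist_le => //; exact: cvg_id.
  case: (leP s t) => st.
    by rewrite ger0_norm ?subr_ge0// => ?; have := F_lip _ _ st; rewrite ler_norml; lra.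
  by rewrite ltr0_norm ?subr_lt0// => ?; have := F_lip _ _ (ltW st); rewrite ler_norml; lra.
have [n eFn] : exists n : nat, (e <= F n%:R)%R.
  have [|||n en] := @nnborel_bigcup_gt w (fun n => `]-oo, n%:R]%classic) e nw.
  - move=> m n mn; rewrite subsetEset; apply: subset_itvl.
    by rewrite bnd_simp ler_nat.
  - by [].
  - rewrite (_ : \bigcup_n _ = setT) ?wa ?lte_fin//.
    apply/seteqP; split=> // x _; exists (Num.truncn x).+1 => //=.
    by rewrite in_itv/= ltW// Num.Theory.truncnS_gt.
  - by exists n; rewrite -lee_fin FE ltW.
have [m eFm] : exists m : nat, (F (- m%:R) <= e)%R.
  have [|||m em] := @nnborel_bigcup_gt w (fun n => `](- n%:R)%R, +oo[%classic) (a - e) nw.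
  - move=> m k mk; rewrite subsetEset; apply: subset_itvr.
    by rewrite bnd_simp lerN2 ler_nat.
  - by [].
  - rewrite bigcup_right_rays wa lte_fin; lra.
  - exists m; rewrite -lee_fin FE -integral_indicM//.
    have := integral_setC_split (mI (- m%:R)%R) nw.
    rewrite wa [X in _ + X]integral_indicM; last exact: measurableC.
    rewrite setCitvl => aE; rewrite leNgt; apply/negP => eF.
    by have := lteD eF em; rewrite -aE -EFinD addrC subrK ltxx.
have [t _ Fte] : exists2 t, t \in `[- m%:R, n%:R]%R & F t = e.
  apply: IVT; first by rewrite (@le_trans _ _ 0)%R// oppr_le0.
    exact: continuous_subspaceT.
  by rewrite ge_min le_max eFn eFm orbT.
exists `]-oo, t]%classic; split=> //.
  by move=> x y /=; rewrite !in_itv/= => xt /negP; rewrite -ltNge; apply: le_lt_trans.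
by rewrite integral_indicM// -FE Fte.
Unshelve. all: by end_near.
Qed.

End weights.

(** * The trilinear form of a convolution *)

Section pairing.
Context {R : realType}.
Implicit Types (w g G f : R -> \bar R) (a c e : R).

Lemma convolutionE f g x : nnborel f -> nnborel g ->
  convolution f g x = \int[mu]_y (f (x - y)%R * g y).
Proof.
move=> nf ng; apply: integral_lebesgue_borel.
by apply: nnborelM => //; exact: nnborel_affine_comp _ true _.
Qed.

Lemma nnborel_convolution_kernel f g : nnborel f -> nnborel g ->
  measurable_fun [set: measurableTypeR R * measurableTypeR R]
    (fun p : R * R => f (p.1 - p.2)%R * g p.2).
Proof.
move=> [mf _] [mg _]; apply: emeasurable_funM.
  apply: (measurableT_comp mf) => /=.
  by apply: measurable_funB; [exact: measurable_fst|exact: measurable_snd].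
by apply: (measurableT_comp mg); exact: measurable_snd.
Qed.

(** Measurability of a partial integral, from Tonelli's theorem. *)
Lemma nnborel_convolution f g : nnborel f -> nnborel g ->
  nnborel (convolution f g).
Proof.
move=> nf ng.
have k_ge0 (p : R * R) : 0 <= f (p.1 - p.2)%R * g p.2.
  by rewrite mule_ge0 ?(nf.2) ?(ng.2).
rewrite (_ : convolution f g = fun x => \int[mu]_y (f (x - y)%R * g y)).
  split; last by move=> x; apply: integral_ge0 => y _; exact: (k_ge0 (x, y)).
  exact: (@measurable_fun_fubini_tonelli_F _ _ (measurableTypeR R)
    (measurableTypeR R) R mu (fun p => f (p.1 - p.2)%R * g p.2) (nnborel_convolution_kernel nf ng) k_ge0).
by apply/funext => x; exact: convolutionE.
Qed.

(** The form [\int \int w(x) G(x - z) g(z)], additive in [w] and in [g], on which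
    hooks are cut out. *)
Definition pairing G w g := \int[mu]_x (w x * convolution G g x).

Lemma pairing_swap G w g : nnborel G -> nnborel w -> nnborel g ->
  pairing G w g = \int[mu]_y (g y * \int[mu]_x (w x * G (x - y)%R)).
Proof.
move=> nG nw ng; have [mG G0] := nG; have [mw w0] := nw; have [mg g0] := ng.
have k_ge0 (p : R * R) : 0 <= w p.1 * (G (p.1 - p.2)%R * g p.2).
  by rewrite !mule_ge0.
have mk : measurable_fun [set: measurableTypeR R * measurableTypeR R]
    (fun p : R * R => w p.1 * (G (p.1 - p.2)%R * g p.2)).
  apply: emeasurable_funM; last exact: nnborel_convolution_kernel.
  by apply: (measurableT_comp mw); exact: measurable_fst.
transitivity (\int[mu]_x \int[mu]_y (w x * (G (x - y)%R * g y))).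
  apply: eq_integral => x _; rewrite convolutionE// ge0_integralZl//.
  - exact: (nnborelM (nnborel_affine_comp x true nG) ng).1.
  - by move=> y _; rewrite mule_ge0.
rewrite (@fubini_tonelli _ _ (measurableTypeR R) (measurableTypeR R) R mu mu
  (fun p => w p.1 * (G (p.1 - p.2)%R * g p.2)) mk k_ge0).
apply: eq_integral => y _; rewrite -ge0_integralZl//.
- by apply: eq_integral => x _; rewrite muleA muleC.
- apply: (nnborelM nw _).1.
  have := nnborel_affine_comp (- y)%R false nG.
  by congr nnborel; apply/funext => x; rewrite addrC.
- by move=> x _; rewrite mule_ge0.
Qed.

Lemma pairingDl G w w' g : nnborel G -> nnborel w -> nnborel w' -> nnborel g ->
  pairing G (fun x => w x + w' x) g = pairing G w g + pairing G w' g.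
Proof.
move=> nG nw nw' ng; have nc := nnborel_convolution nG ng.
rewrite /pairing -(integral_nnborelD (nnborelM nw nc) (nnborelM nw' nc)).
by apply: eq_integral => x _; rewrite ge0_muleDl ?(nw.2) ?(nw'.2).
Qed.

Lemma pairingDr G w g g' : nnborel G -> nnborel w -> nnborel g -> nnborel g' ->
  pairing G w (fun x => g x + g' x) = pairing G w g + pairing G w g'.
Proof.
move=> nG nw ng ng'.
rewrite /pairing -(integral_nnborelD (nnborelM nw (nnborel_convolution nG ng))
  (nnborelM nw (nnborel_convolution nG ng'))).
apply: eq_integral => x _.
rewrite -ge0_muleDr ?(nnborel_convolution _ _).2//.
have nGx := nnborel_affine_comp x true nG.
congr (_ * _); rewrite !convolutionE//; last exact: nnborelD.
rewrite -(integral_nnborelD (nnborelM nGx ng) (nnborelM nGx ng')).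
by apply: eq_integral => y _; rewrite ge0_muleDr ?(ng.2) ?(ng'.2).
Qed.

Lemma subunit_convolution G g : subunit G -> nnborel g ->
  \int[mu]_x g x = 1 -> subunit (convolution G g).
Proof.
move=> uG ng g1; split; first exact: nnborel_convolution uG.1 ng.
move=> x; rewrite (convolutionE _ uG.1 ng) -g1.
apply: le_integral_nnborel => //.
  by apply: nnborelM => //; exact: nnborel_affine_comp _ true uG.1.
by move=> y; rewrite -[leRHS]mul1e lee_wpmul2r ?(ng.2) ?(uG.2).
Qed.

(** Tonelli's theorem for the pairing with the constant 1. *)
Lemma integral_convolution f g : nnborel f -> nnborel g ->
  \int[mu]_x convolution f g x = \int[mu]_x f x * \int[mu]_x g x.
Proof.
move=> nf ng; transitivity (pairing f (cst 1) g).
  by apply: eq_integral => x _; rewrite mul1e.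
have n1 : nnborel (cst 1 : R -> \bar R) by split.
rewrite pairing_swap//.
transitivity (\int[mu]_y (g y * \int[mu]_x f x)).
  apply: eq_integral => y _; congr (_ * _).
  rewrite -(integral_shift (- y)%R nf).
  by apply: eq_integral => x _; rewrite mul1e addrC.
rewrite ge0_integralZr//; last 3 first.
- exact: ng.1.
- by move=> y _; exact: ng.2.
- by apply: integral_ge0 => x _; exact: nf.2.
by rewrite muleC.
Qed.

Lemma pairing_le G w g a c : subunit G -> weight w a -> weight g c ->
  pairing G w g <= (a * c)%:E.
Proof.
move=> [nG G1] [[nw w1] wa] [[ng g1] gc].
have c0 : (0 <= c)%R by exact: weight_ge0 (conj (conj ng g1) gc).
apply: (@le_trans _ _ (\int[mu]_x (c%:E * w x))); last first.
  by rewrite integral_nnborelZ// wa -EFinM mulrC.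
apply: le_integral_nnborel; first exact: nnborelM nw (nnborel_convolution nG ng).
  exact: nnborelZ.
move=> x; rewrite muleC lee_wpmul2r ?(nw.2)// convolutionE// -gc.
apply: le_integral_nnborel => //.
  by apply: nnborelM ng; exact: nnborel_affine_comp _ true nG.
by move=> y; rewrite -[leRHS]mul1e lee_wpmul2r ?(ng.2).
Qed.

End pairing.

(** * Peeling off a hook *)

Section hooks.
Context {R : realType}.
Implicit Types (w g G M : R -> \bar R) (a c e s : R).

Lemma integral_restrict_le w p (A : set R) e r :
  weight w e -> (forall x, ~ A x -> w x = 0) -> nnborel p -> (0 <= r)%R ->
  (forall x, A x -> p x <= r%:E) -> \int[mu]_x (w x * p x) <= (r * e)%:E.
Proof.
move=> [[nw w1] we] wA np r0 pr.
rewrite EFinM -we -integral_nnborelZ//; apply: le_integral_nnborel.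
- exact: nnborelM.
- exact: nnborelZ.
move=> x; rewrite muleC; have [Ax|nAx] := pselect (A x).
  by rewrite lee_wpmul2r ?(nw.2)// pr.
by rewrite wA// !mule0.
Qed.

(** The bound [s] on the sums [p x + q z] need not split into separate bounds for
    [p] and [q] given beforehand; the supremum of [p] over [A] provides the split. *)
Lemma paired_integrals_le w g p q (A C : set R) e s :
  (0 < e)%R ->
  weight w e -> (forall x, ~ A x -> w x = 0) ->
  weight g e -> (forall z, ~ C z -> g z = 0) ->
  nnborel p -> nnborel q -> (forall x z, A x -> C z -> p x + q z <= s%:E) ->
  \int[mu]_x (w x * p x) + \int[mu]_z (g z * q z) <= (e * s)%:E.
Proof.
move=> e0 we wA ge gC np nq pqs.
have inhabited f (D : set R) : weight f e -> (forall x, ~ D x -> f x = 0) ->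
    exists x, D x.
  move=> [_ fe] fD; apply: contrapT => /forallNP noD; move: fe.
  rewrite integral0_eq => [/eqP|x _]; last exact/fD/noD.
  by rewrite eqe lt_eqF.
have [x0 Ax0] := inhabited _ _ we wA; have [z0 Cz0] := inhabited _ _ ge gC.
have p_s x : A x -> p x <= s%:E.
  by move=> Ax; apply: le_trans (pqs _ _ Ax Cz0); rewrite leeDl// (nq.2).
have q_s z : C z -> q z <= s%:E.
  by move=> Cz; apply: le_trans (pqs _ _ Ax0 Cz); rewrite leeDr// (np.2).
have fin_p x : A x -> p x \is a fin_num.
  by move=> /p_s px; rewrite ge0_fin_numE ?(np.2)// (le_lt_trans px)// ltry.
have fin_q z : C z -> q z \is a fin_num.
  by move=> /q_s qz; rewrite ge0_fin_numE ?(nq.2)// (le_lt_trans qz)// ltry.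
pose S := (fine \o p) @` A.
have S_ub z : C z -> ubound S (s - fine (q z))%R.
  move=> Cz _ [x Ax <-] /=; rewrite lerBrDr -lee_fin EFinD !fineK ?fin_p ?fin_q//.
  exact: pqs.
have hS : has_sup S.
  by split; [exists (fine (p x0)), x0|exists (s - fine (q z0))%R; exact: S_ub].
have le_supS x : A x -> p x <= (sup S)%:E.
  move=> Ax; rewrite -(fineK (fin_p _ Ax)) lee_fin.
  by apply: sup_upper_bound => //; exists x.
have sup0 : (0 <= sup S)%R.
  by rewrite -lee_fin (le_trans _ (le_supS _ Ax0))// (np.2).
have q_sup z : C z -> q z <= (s - sup S)%:E.
  move=> Cz; rewrite -(fineK (fin_q _ Cz)) lee_fin lerBrDl -lerBrDr.
  by apply: ge_sup; [exact: hS.1|exact: S_ub].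
have s_sup : (0 <= s - sup S)%R.
  by rewrite -lee_fin (le_trans _ (q_sup _ Cz0))// (nq.2).
have -> : (e * s = sup S * e + (s - sup S) * e)%R by ring.
rewrite EFinD; apply: leeD.
- exact: integral_restrict_le le_supS.
- exact: integral_restrict_le q_sup.
Qed.

(** A correlation is a convolution with the reflected function. *)
Lemma nnborel_correlation G w : nnborel G -> nnborel w ->
  nnborel (fun z => \int[mu]_u (w u * G (u - z)%R)).
Proof.
move=> nG nw; have nGN := nnborel_affine_comp 0 true nG.
have := nnborel_convolution nGN nw; congr nnborel; apply/funext => z.
rewrite (convolutionE _ nGN nw); apply: eq_integral => u _.
by rewrite add0r opprB muleC.
Qed.

Definition dominated_by G (S : R -> \bar R) :=
  forall w a, weight w a -> \int[mu]_x (w x * G x) <= S a.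

(** For [x] in the left part of [w] and [z] in the left part of [g], the two
    integrals over the arms of the hook with corner [(x, z)] are integrals of
    [G] against functions living on either side of [x - z], so that their sum
    still has values in [0, 1].  Here [w] and [g] stand for the parts that remain
    once their left parts, on [A] and [C], have been cut off. *)
Lemma hook_le G (S : R -> \bar R) w g (A C : set R) a c x z :
  subunit G -> dominated_by G S ->
  weight w a -> (forall u, A u -> w u = 0) -> (forall u v, A u -> ~ A v -> (u < v)%R) ->
  weight g c -> (forall v, C v -> g v = 0) -> (forall u v, C u -> ~ C v -> (u < v)%R) ->
  A x -> C z ->
  convolution G g x + \int[mu]_u (w u * G (u - z)%R) <= S (a + c)%R.
Proof.
move=> uG GS ww wA ltA wg gC ltC Ax Cz.
have [[nw w1] wa] := ww; have [[ng g1] gc] := wg; have nG := uG.1.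
(* The first summand lives on [y < x - z], the second one on [y > x - z]. *)
pose v y := g (x - y)%R + w (z + y)%R.
have nv1 := nnborel_affine_comp x true ng.
have nv2 := nnborel_affine_comp z false nw.
have -> : convolution G g x = \int[mu]_y (g (x - y)%R * G y).
  rewrite (convolutionE _ nG ng) -(integral_reflect x); last first.
    by apply: nnborelM ng; exact: nnborel_affine_comp _ true nG.
  by apply: eq_integral => y _; rewrite muleC subKr.
have -> : \int[mu]_u (w u * G (u - z)%R) = \int[mu]_y (w (z + y)%R * G y).
  rewrite -(integral_shift z); last first.
    apply: nnborelM nw _; have := nnborel_affine_comp (- z)%R false nG.
    by congr nnborel; apply/funext => u; rewrite addrC.
  by apply: eq_integral => y _; rewrite [(z + y)%R]addrC addrK.
rewrite -(integral_nnborelD (nnborelM nv1 nG) (nnborelM nv2 nG)).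
apply: le_trans (GS v _ _); last first.
  split.
    split; first exact: nnborelD.
    move=> y; rewrite /v.
    have [Cxy|nCxy] := pselect (C (x - y)%R); first by rewrite gC// add0e.
    have [Azy|nAzy] := pselect (A (z + y)%R); first by rewrite wA// adde0.
    by exfalso; have := ltA _ _ Ax nAzy; have := ltC _ _ Cz nCxy; lra.
  rewrite /v (integral_nnborelD nv1 nv2) integral_reflect// integral_shift//.
  by rewrite gc wa -EFinD addrC.
apply: le_integral_nnborel.
- by apply: nnborelD; exact: nnborelM.
- by apply: nnborelM nG; exact: nnborelD.
- by move=> y; rewrite ge0_muleDl ?(nv1.2) ?(nv2.2).
Qed.

(** Cutting off the leftmost mass [e] of [w] and of [g] divides the parameter
    rectangle into a square of side [e], a smaller rectangle, and two strips that
    make up hooks.  The square contributes at most [e ^+ 2] because [G <= 1], and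
    the strips are estimated together by [hook_le]. *)
Lemma hook_step G (S : R -> R) w g a c e :
  subunit G -> dominated_by G (EFin \o S) -> weight w a -> weight g c ->
  (0 < e)%R -> (e <= a)%R -> (e <= c)%R ->
  exists w' g', [/\ weight w' (a - e), weight g' (c - e) &
    pairing G w g <= (e ^+ 2 + e * S (a + c - 2 * e))%:E + pairing G w' g'].
Proof.
move=> uG GS ww wg e0 ea ec.
have [A [mA ltA wAe]] : exists A : set R, [/\ measurable A,
    forall x y, A x -> ~ A y -> (x < y)%R &
    \int[mu]_x (w x * (\1_A x)%:E) = e%:E].
  by apply: (weight_cut ww); rewrite (ltW e0).
have [C [mC ltC gCe]] : exists A : set R, [/\ measurable A,
    forall x y, A x -> ~ A y -> (x < y)%R &
    \int[mu]_x (g x * (\1_A x)%:E) = e%:E].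
  by apply: (weight_cut wg); rewrite (ltW e0).
have [w1 w2] := weight_split mA ww wAe; have [g1 g2] := weight_split mC wg gCe.
set w' := (fun x => w x * (\1_A x)%:E) in w1 wAe.
set w'' := (fun x => w x * (\1_(~` A) x)%:E) in w2.
set g' := (fun x => g x * (\1_C x)%:E) in g1 gCe.
set g'' := (fun x => g x * (\1_(~` C) x)%:E) in g2.
exists w'', g''; split=> //.
have nG := uG.1; have nw1 := w1.1.1; have nw2 := w2.1.1.
have ng1 := g1.1.1; have ng2 := g2.1.1.
have splitE (f : R -> \bar R) (D : set R) :
    f = (fun x => f x * (\1_D x)%:E + f x * (\1_(~` D) x)%:E).
  apply/funext => x; rewrite !indicE in_setC.
  by case: (x \in D); rewrite /= mule1 mule0 ?add0e ?adde0.
have -> : pairing G w g = pairing G w' g' + (pairing G w' g'' + pairing G w'' g')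
    + pairing G w'' g''.
  have ng := wg.1.1.
  have -> : pairing G w g = pairing G w' g + pairing G w'' g.
    by rewrite -(pairingDl nG nw1 nw2 ng); congr pairing; exact: splitE.
  have gE : g = (fun x => g' x + g'' x) by exact: splitE.
  have -> : pairing G w' g = pairing G w' g' + pairing G w' g''.
    by rewrite -(pairingDr nG nw1 ng1 ng2); congr pairing.
  have -> : pairing G w'' g = pairing G w'' g' + pairing G w'' g''.
    by rewrite -(pairingDr nG nw2 ng1 ng2); congr pairing.
  by move: (pairing _ _ _) (pairing G _ _) (pairing _ _ _) (pairing _ _ _) => *;
    rewrite !addeA.
apply: leeD2r; rewrite EFinD; apply: leeD.
  by rewrite expr2; exact: pairing_le w1 g1.
rewrite [X in _ + X](pairing_swap nG nw2 ng1).
have nq := nnborel_correlation nG nw2.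
apply: (paired_integrals_le (A := A) (C := C) e0 w1 _ g1 _ _ nq).
- by move=> x nAx; rewrite /w' indicE memNset// mule0.
- by move=> x nCx; rewrite /g' indicE memNset// mule0.
- exact: nnborel_convolution.
- move=> x z Ax Cz.
  have -> : (a + c - 2 * e = (a - e) + (c - e))%R by ring.
  apply: (hook_le (A := A) (C := C) uG GS w2 _ ltA g2 _ ltC Ax Cz).
  + by move=> u Au; rewrite /w'' indicE memNset ?mule0//; apply.
  + by move=> u Cu; rewrite /g'' indicE memNset ?mule0//; apply.
Qed.

End hooks.

(** * Hooks of centered intervals *)

Section boxes.
Context {R : realType}.
Implicit Types (w g G M : R -> \bar R) (a c e r : R).

Definition itv_indic (i : interval R) : R -> \bar R := EFin \o \1_[set` i].

Lemma itv_indicE i x : itv_indic i x = (x \in i)%:R%:E.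
Proof. by rewrite /itv_indic /= indicE mem_setE. Qed.

Lemma subunit_itv_indic i : subunit (itv_indic i).
Proof. by apply: subunit_indic; exact: measurable_itv. Qed.

Lemma nnborel_itv_indic i : nnborel (itv_indic i).
Proof. exact: (subunit_itv_indic i).1. Qed.

Lemma weight_itv_indic (a b : R) (x y : bool) : (a <= b)%R ->
  weight (itv_indic (Interval (BSide x a) (BSide y b))) (b - a).
Proof.
move=> ab; split; first exact: subunit_itv_indic.
rewrite integral_indic; [|exact: measurableT|exact: measurable_itv].
rewrite setIT /= lebesgue_measure_itv/= lte_fin -EFinB.
by case: ltP => ba //; congr EFin; lra.
Qed.

Definition box r : R -> \bar R := itv_indic `](- (r / 2))%R, (r / 2)%R[.

Lemma boxE r x : box r x = (`|x| < r / 2)%R%:R%:E.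
Proof. by rewrite /box itv_indicE in_itv/= -ltr_norml. Qed.

Lemma weight_box r : (0 <= r)%R -> weight (box r) r.
Proof.
move=> r0; have le_r : (- (r / 2) <= r / 2)%R by lra.
have := weight_itv_indic false true le_r.
by congr weight; lra.
Qed.

Definition central_mass M r := fine (\int[mu]_x (box r x * M x)).

Lemma central_massE M r : subunit M -> (0 <= r)%R ->
  (central_mass M r)%:E = \int[mu]_x (box r x * M x).
Proof.
move=> uM r0; have [ur rr] := weight_box r0; rewrite /central_mass fineK//.
have nrM := nnborelM ur.1 uM.1.
rewrite ge0_fin_numE ?integral_ge0// => [|x _]; last exact: nrM.2.
apply: le_lt_trans (ltry r); rewrite -rr; apply: le_integral_nnborel => //.
  exact: ur.1.
by move=> x; rewrite -[leRHS]mule1 lee_wpmul2l ?(uM.2) ?(ur.1.2).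
Qed.

Lemma pairing_shift M w g a : nnborel M -> nnborel w -> nnborel g ->
  pairing M (fun x => w (a + x)%R) (fun y => g (a + y)%R) = pairing M w g.
Proof.
move=> nM nw ng; have nga := nnborel_affine_comp a false ng.
rewrite /pairing -(integral_shift a (nnborelM nw (nnborel_convolution nM ng))).
apply: eq_integral => x _; congr (_ * _).
rewrite !convolutionE// -[RHS](integral_shift a); last first.
  by apply: nnborelM => //; exact: nnborel_affine_comp _ true nM.
by apply: eq_integral => y _; rewrite opprD addrACA subrr add0r.
Qed.

Lemma pairing_mono M w w' g g' : nnborel M -> nnborel w -> nnborel w' ->
  nnborel g -> nnborel g' -> (forall x, w x <= w' x) -> (forall y, g y <= g' y) ->
  pairing M w g <= pairing M w' g'.
Proof.
move=> nM nw nw' ng ng' ww' gg'.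
have nc := nnborel_convolution nM ng; have nc' := nnborel_convolution nM ng'.
apply: (le_integral_nnborel (nnborelM nw nc) (nnborelM nw' nc')) => x.
apply: lee_pmul; [exact: nw.2|exact: nc.2|exact: ww'|].
rewrite !convolutionE//; have nMx := nnborel_affine_comp x true nM.
apply: (le_integral_nnborel (nnborelM nMx ng) (nnborelM nMx ng')) => y.
by apply: lee_wpmul2l => //; exact: nMx.2.
Qed.

Lemma le_integral_weight w p e (s : \bar R) : weight w e -> nnborel p ->
  0 <= s -> (forall x, w x = 0 \/ s <= p x) -> e%:E * s <= \int[mu]_x (w x * p x).
Proof.
move=> [[nw w1] <-] np s0 sp; have [mw w0] := nw.
rewrite -ge0_integralZr//; apply: le_integral_nnborel.
- by apply: nnborelM => //; split.
- exact: nnborelM.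
- move=> x; have [->|spx] := sp x; first by rewrite !mul0e.
  by rewrite lee_wpmul2l.
Qed.

(** The extremal counterpart of [hook_step].  If [x] and [z] are within [e] of the
    left ends of the two intervals, the values [x - y] reached along one arm
    cover [I1], the values reached along the other arm cover [I2], and what they
    miss of the central interval is covered by the interval [I0] of length [e],
    on which [M <= 1].  Averaged over the strips of width [e], this costs
    [e ^+ 2]. *)
Lemma box_hook_step M a c e : subunit M -> (0 < e)%R -> (e <= a)%R -> (e <= c)%R ->
  (e * central_mass M (a + c - 2 * e))%:E + pairing M (box (a - e)) (box (c - e))
    <= pairing M (box a) (box c) + (e ^+ 2)%:E.
Proof.
move=> uM e0 ea ec.
have nM := uM.1.
pose w' := itv_indic `](- (a / 2))%R, (- (a / 2) + e)%R[.
pose w'' := itv_indic `](- (a / 2) + e)%R, (a / 2)%R[.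
pose g' := itv_indic `](- (c / 2))%R, (- (c / 2) + e)%R[.
pose g'' := itv_indic `](- (c / 2) + e)%R, (c / 2)%R[.
(* The intervals [I1], [I0], [I2] are adjacent and cover the central interval of
   length [a + c - 2 * e]. *)
pose I1 := itv_indic `](- ((a + c) / 2) + e)%R, ((c - a) / 2)%R].
pose I0 := itv_indic `]((c - a) / 2)%R, ((c - a) / 2 + e)%R].
pose I2 := itv_indic `]((c - a) / 2 + e)%R, ((a + c) / 2 - e)%R[.
have ni := nnborel_itv_indic.
have nw' : nnborel w' by exact: ni.
have nw'' : nnborel w'' by exact: ni.
have ng' : nnborel g' by exact: ni.
have ng'' : nnborel g'' by exact: ni.
have nc : nnborel (box c) by exact: ni.
have e_ge0 : 0 <= e%:E by rewrite lee_fin ltW.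
have ww' : weight w' e.
  have := @weight_itv_indic (- (a / 2)) (- (a / 2) + e) false true.
  by rewrite addrAC subrr add0r; apply; lra.
have wg' : weight g' e.
  have := @weight_itv_indic (- (c / 2)) (- (c / 2) + e) false true.
  by rewrite addrAC subrr add0r; apply; lra.
have wI0 : weight I0 e.
  have := @weight_itv_indic ((c - a) / 2) ((c - a) / 2 + e) false false.
  by rewrite addrAC subrr add0r; apply; lra.
have le_box r x : (e <= r)%R ->
    itv_indic `](- (r / 2))%R, (- (r / 2) + e)%R[ x
    + itv_indic `](- (r / 2) + e)%R, (r / 2)%R[ x <= box r x.
  move=> er; rewrite /box !itv_indicE !in_itv/= -EFinD lee_fin -natrD ler_nat.
  case: (boolP (- (r / 2) < x < - (r / 2) + e)%R);
  case: (boolP (- (r / 2) + e < x < r / 2)%R);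
  by case: (boolP (- (r / 2) < x < r / 2)%R) => //= *; exfalso; lra.
(* Cutting off [e] on the left moves both centers by the same [e / 2], which
   leaves the differences [x - z] unchanged. *)
have -> : pairing M (box (a - e)) (box (c - e)) = pairing M w'' g''.
  have box_shift r : box (r - e) = (fun x =>
      itv_indic `](- (r / 2) + e)%R, (r / 2)%R[ (e / 2 + x)%R).
    apply/funext => x; rewrite /box !itv_indicE !in_itv/=; congr ((nat_of_bool _)%:R%:E).
    by apply/idP/idP => *; lra.
  rewrite !box_shift; exact: (pairing_shift (e / 2) nM (ni _) (ni _)).
have mass_split : (central_mass M (a + c - 2 * e))%:E <=
    \int[mu]_x (I1 x * M x) + \int[mu]_x (I0 x * M x) + \int[mu]_x (I2 x * M x).
  rewrite central_massE//; last by lra.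
  rewrite -(integral_nnborelD (nnborelM (ni _) nM) (nnborelM (ni _) nM)).
  rewrite -(integral_nnborelD
    (nnborelD (nnborelM (ni _) nM) (nnborelM (ni _) nM)) (nnborelM (ni _) nM)).
  apply: le_integral_nnborel.
  - exact: nnborelM (ni _) nM.
  - by apply: nnborelD; [apply: nnborelD|]; exact: nnborelM (ni _) nM.
  move=> x; have I_ge0 i : 0 <= itv_indic i x by exact: (ni i).2.
  rewrite -!ge0_muleDl ?adde_ge0 ?I_ge0//.
  apply: lee_wpmul2r; first exact: nM.2.
  rewrite /box !itv_indicE !in_itv/= -!EFinD lee_fin -!natrD ler_nat.
  move: (boolP (- ((a + c - 2 * e) / 2) < x < (a + c - 2 * e) / 2)%R).
  case=> // xac.
  case: (boolP (- ((a + c) / 2) + e < x <= (c - a) / 2)%R) => // x1.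
  case: (boolP ((c - a) / 2 < x <= (c - a) / 2 + e)%R) => // x0.
  case: (boolP ((c - a) / 2 + e < x < (a + c) / 2 - e)%R) => // x2.
  by exfalso; lra.
have S1 : e%:E * \int[mu]_x (I1 x * M x) <= pairing M w' (box c).
  apply: (le_integral_weight ww').
  - exact: nnborel_convolution nM (ni _).
  - by apply: integral_ge0 => x _; exact: (nnborelM (ni _) nM).2.
  move=> x; rewrite {1}/w' itv_indicE in_itv/=.
  have [xa|] := boolP (_ < x < _)%R; [right|by left].
  have nMx := nnborel_affine_comp x true nM.
  rewrite (convolutionE _ nM (ni _)) -(integral_reflect x (nnborelM nMx (ni _))).
  have ncx := nnborel_affine_comp x true (ni `](- (c / 2))%R, (c / 2)%R[).
  have -> : \int[mu]_y (M (x - (x - y))%R * box c (x - y)%R) =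
      \int[mu]_y (box c (x - y)%R * M y).
    by apply: eq_integral => y _; rewrite muleC subKr.
  apply: (le_integral_nnborel (nnborelM (ni _) nM) (nnborelM ncx nM)) => y.
  apply: lee_wpmul2r; first exact: nM.2.
  rewrite /w'' /box !itv_indicE !in_itv/= lee_fin ler_nat.
  case: (boolP (- ((a + c) / 2) + e < y <= (c - a) / 2)%R) => // y1.
  case: (boolP (- (c / 2) < x - y < c / 2)%R) => // y2.
  by exfalso; lra.
have S2 : e%:E * \int[mu]_x (I2 x * M x) <= pairing M w'' g'.
  rewrite (pairing_swap nM (ni _) (ni _)).
  apply: (le_integral_weight wg').
  - exact: nnborel_correlation nM (ni _).
  - by apply: integral_ge0 => x _; exact: (nnborelM (ni _) nM).2.
  move=> z; rewrite {1}/g' itv_indicE in_itv/=.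
  have [zc|] := boolP (_ < z < _)%R; [right|by left].
  have nMz : nnborel (fun u => M (u - z)%R).
    have := nnborel_affine_comp (- z)%R false nM.
    by congr nnborel; apply/funext => u; rewrite addrC.
  rewrite -(integral_shift z (nnborelM (ni _) nMz)).
  have nwz := nnborel_affine_comp z false (ni `](- (a / 2) + e)%R, (a / 2)%R[).
  have -> : \int[mu]_y (w'' (z + y)%R * M (z + y - z)%R) =
      \int[mu]_y (w'' (z + y)%R * M y).
    by apply: eq_integral => y _; rewrite [(z + y)%R]addrC addrK.
  apply: (le_integral_nnborel (nnborelM (ni _) nM) (nnborelM nwz nM)) => y.
  apply: lee_wpmul2r; first exact: nM.2.
  rewrite /w'' /box !itv_indicE !in_itv/= lee_fin ler_nat.
  case: (boolP ((c - a) / 2 + e < y < (a + c) / 2 - e)%R) => // y1.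
  case: (boolP (- (a / 2) + e < z + y < a / 2)%R) => // y2.
  by exfalso; lra.
have S0 : \int[mu]_x (I0 x * M x) <= e%:E.
  rewrite -wI0.2; apply: (le_integral_nnborel (nnborelM (ni _) nM) (ni _)).
  by move=> x; rewrite -[leRHS]mule1 lee_wpmul2l ?(uM.2) ?((ni _).2).
have P0 : pairing M w' (box c) + (pairing M w'' g' + pairing M w'' g'')
    <= pairing M (box a) (box c).
  have g_box y : g' y + g'' y <= box c y by exact: le_box.
  have w_box x : w' x + w'' x <= box a x by exact: le_box.
  have na : nnborel (box a) by exact: ni.
  have := pairing_mono nM nw'' nw'' (nnborelD ng' ng'') nc (fun=> lexx _) g_box.
  rewrite (pairingDr nM nw'' ng' ng'') => Lg.
  have := pairing_mono nM (nnborelD nw' nw'') na nc nc w_box (fun=> lexx _).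
  rewrite (pairingDl nM nw' nw'' nc); exact: le_trans (leeD2l _ Lg).
apply: (le_trans _ (leeD2r _ P0)).
have i1 : 0 <= \int[mu]_x (I1 x * M x).
  by apply: integral_ge0 => x _; exact: (nnborelM (ni _) nM).2.
have i2 : 0 <= \int[mu]_x (I2 x * M x).
  by apply: integral_ge0 => x _; exact: (nnborelM (ni _) nM).2.
have i0 : 0 <= \int[mu]_x (I0 x * M x).
  by apply: integral_ge0 => x _; exact: (nnborelM (ni _) nM).2.
move: mass_split S1 S2 S0 i1 i2 i0.
move: (\int[mu]_x (I1 x * M x)) (\int[mu]_x (I2 x * M x)) (\int[mu]_x (I0 x * M x)).
move: (pairing M w' (box c)) (pairing M w'' g') (pairing M w'' g'').
move: (central_mass _ _) => S p1 p2 p3 s1 s2 s0 Sle p1s p2s s0e s1_ge s2_ge s0_ge.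
rewrite EFinM; apply: (@le_trans _ _ ((e%:E * s1 + e%:E * s2 + e%:E * e%:E) + p3)).
  apply: leeD2r.
  apply: (@le_trans _ _ (e%:E * (s1 + s0 + s2))); first exact: lee_wpmul2l.
  by rewrite ge0_muleDr ?adde_ge0// ge0_muleDr// addeAC leeD2l// lee_wpmul2l.
rewrite expr2 EFinM addeAC; apply: leeD2r.
by rewrite addeA; apply: leeD2r; exact: leeD.
Qed.

End boxes.

(** * Majorization of convolutions by B-splines *)

Section majorization.
Context {R : realType}.
Implicit Types (w g G M : R -> \bar R) (a c e r : R).

Definition majorized G M := dominated_by G (EFin \o central_mass M).

(** In each step [hook_step] and [box_hook_step] involve the same central mass of
    [M], so that only the two errors [e ^+ 2] accumulate.  The last summand bounds
    the pairing of what is left of [w] and [g]. *)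
Lemma hook_iter G M (n : nat) e : subunit G -> subunit M -> majorized G M ->
  (0 < e)%R -> forall w g a c, weight w a -> weight g c ->
  (n%:R * e <= a)%R -> (n%:R * e <= c)%R ->
  pairing G w g <= pairing M (box a) (box c)
    + (n%:R * (2 * e ^+ 2) + (a - n%:R * e) * (c - n%:R * e))%:E.
Proof.
move=> uG uM GM e0; elim: n => [|n IHn] w g a c ww wg na nc.
  rewrite !mul0r !subr0 add0r; apply: (le_trans (pairing_le uG ww wg)).
  rewrite leeDr//; apply: integral_ge0 => x _; apply: mule_ge0.
    exact: (subunit_itv_indic _).1.2.
  apply: (nnborel_convolution uM.1 _).2.
  exact: (subunit_itv_indic _).1.
have n_ge0 : (0 <= n%:R * e)%R by rewrite mulr_ge0// ltW.
have nSe : (n.+1%:R * e = n%:R * e + e)%R by rewrite -natr1 mulrDl mul1r.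
rewrite nSe in na nc; rewrite nSe.
have ea : (e <= a)%R by lra.
have ec : (e <= c)%R by lra.
have [w' [g' [ww' wg' step]]] := hook_step uG GM ww wg e0 ea ec.
apply: (le_trans step).
have na' : (n%:R * e <= a - e)%R by lra.
have nc' : (n%:R * e <= c - e)%R by lra.
apply: (le_trans (leeD2l _ (IHn _ _ _ _ ww' wg' na' nc'))).
have := box_hook_step uM e0 ea ec.
move: (pairing M (box (a - e)) _) (pairing M (box a) _) (central_mass _ _) => p q S.
have nS : (n.+1%:R = n%:R + 1 :> R)%R by rewrite natr1.
rewrite nS => pq.
have -> : ((n%:R + 1) * (2 * e ^+ 2) + (a - (n%:R * e + e)) * (c - (n%:R * e + e)) =
  e ^+ 2 + (e ^+ 2 + (n%:R * (2 * e ^+ 2) +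
   (a - e - n%:R * e) * (c - e - n%:R * e))))%R by ring.
set t := (_ + (_ - _) * _)%R.
rewrite (EFinD (e ^+ 2)%R (e ^+ 2 + t)%R) (EFinD (e ^+ 2)%R t).
rewrite (EFinD (e ^+ 2)%R (e * S)%R) [X in X + _ <= _]addeC addeACA [leRHS]addeA.
exact: leeD2r.
Qed.

(** Cut off [n] hooks of width [m / n], where [m] is the smaller of the two
    masses: nothing is left of one of the densities, and the accumulated error
    [2 * m ^+ 2 / n] tends to zero. *)
Lemma pairing_le_box G M w g a c : subunit G -> subunit M -> majorized G M ->
  weight w a -> weight g c -> pairing G w g <= pairing M (box a) (box c).
Proof.
move=> uG uM GM ww wg.
have a0 := weight_ge0 ww; have c0 := weight_ge0 wg.
pose m := Order.min a c.
have m0 : (0 <= m)%R by rewrite /m le_min a0.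
have [ma mc] : (m <= a)%R /\ (m <= c)%R by rewrite /m !ge_min !lexx orbT.
have mac : ((a - m) * (c - m) = 0)%R.
  by rewrite /m; case: leP => _; rewrite subrr ?mul0r ?mulr0.
have [m_eq0|m_neq0] := eqVneq m 0%R.
  apply: (le_trans (pairing_le uG ww wg)); move: mac; rewrite m_eq0 !subr0 => ->.
  apply: integral_ge0 => x _; apply: mule_ge0.
    exact: (subunit_itv_indic _).1.2.
  apply: (nnborel_convolution uM.1 _).2.
  exact: (subunit_itv_indic _).1.
have m_gt0 : (0 < m)%R by rewrite lt_neqAle eq_sym m_neq0.
apply/lee_addgt0Pr => d d0.
(* The number of hooks is chosen so that the total error is at most [d]. *)
pose n := (Num.truncn (2 * m ^+ 2 / d)).+1.
have n_gt0 : (0 < n%:R :> R)%R by rewrite ltr0n.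
have nm : (n%:R * (m / n%:R) = m)%R by rewrite mulrC divfK ?gt_eqF.
have e0 : (0 < m / n%:R)%R by rewrite divr_gt0.
have := @hook_iter G M n (m / n%:R) uG uM GM e0 w g a c ww wg.
rewrite nm mac addr0 => /(_ ma mc) /le_trans; apply; apply: leeD2l.
rewrite lee_fin.
have -> : (n%:R * (2 * (m / n%:R) ^+ 2) = (2 * m ^+ 2) / n%:R)%R.
  by field; rewrite gt_eqF.
rewrite ler_pdivrMr// [leRHS]mulrC -ler_pdivrMr//.
by apply: ltW; exact: Num.Theory.truncnS_gt.
Qed.

Lemma majorized_convolution G M g : subunit G -> subunit M -> majorized G M ->
  weight g 1 -> majorized (convolution G g) (convolution M (box 1)).
Proof.
move=> uG uM GM wg w a ww /=; have a0 := weight_ge0 ww.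
have wb : weight (box 1 : R -> \bar R) 1 by exact: weight_box.
rewrite (central_massE (subunit_convolution uM wb.1.1 wb.2) a0).
exact: pairing_le_box ww wg.
Qed.

(** The induction starts with [\int w g <= min (\int w) (\int g)], and the right-hand
    side is the mass that a centered interval shares with the unit interval. *)
Lemma majorized_box g : weight g 1 -> majorized g (box 1).
Proof.
move=> [ug g1] w a [uw wa] /=.
have a0 : (0 <= a)%R by exact: weight_ge0 (conj uw wa).
have wb : weight (box 1 : R -> \bar R) 1 by exact: weight_box.
rewrite (central_massE wb.1 a0).
have box_min : \int[mu]_x (box a x * box 1 x) = (Order.min a 1%R)%:E.
  have [_ <-] : weight (box (Order.min a 1%R)) (Order.min a 1%R).
    by apply: weight_box; rewrite le_min a0 ler01.
  apply: eq_integral => x _; rewrite /box !itv_indicE !in_itv/= -EFinM -natrM mulnb.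
  congr ((nat_of_bool _)%:R%:E); by case: (leP a 1%R) => a1; apply/idP/idP => *; lra.
have uwg := subunitM uw ug.
rewrite box_min; case: (leP a 1%R) => _.
- rewrite -wa; apply: (le_integral_nnborel uwg.1 uw.1) => x.
  by rewrite -[leRHS]mule1; apply: lee_wpmul2l; [exact: uw.1.2|exact: ug.2].
- rewrite -g1; apply: (le_integral_nnborel uwg.1 ug.1) => x.
  by rewrite -[leRHS]mul1e; apply: lee_wpmul2r; [exact: ug.1.2|exact: uw.2].
Qed.

Lemma bsplineS n : bspline n.+2 = convolution (bspline n.+1) (box 1) :> (R -> \bar R).
Proof. by []. Qed.

Lemma weight_convolution G g : weight G 1 -> weight g 1 ->
  weight (convolution G g) 1.
Proof.
move=> [uG G1] [ug g1]; split; first exact: subunit_convolution uG ug.1 g1.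
by rewrite (integral_convolution uG.1 ug.1) G1 g1 mule1.
Qed.

Lemma weight_bspline n : weight (bspline n.+1 : R -> \bar R) 1.
Proof.
have wb : weight (box 1 : R -> \bar R) 1 by exact: weight_box.
by elim: n => [|n IHn]; [exact: wb|rewrite bsplineS; exact: weight_convolution].
Qed.

(** The left-bracketed convolution of [g 0, ..., g n], with a sequence of factors
    instead of a list so that an induction peels off the last one. *)
Fixpoint iter_convolution (g : nat -> R -> \bar R) (n : nat) : R -> \bar R :=
  if n is m.+1 then convolution (iter_convolution g m) (g m.+1) else g 0%N.

Lemma convolutions_iota (g : nat -> R -> \bar R) n :
  convolutions [seq g i | i <- iota 0 n.+1] = iter_convolution g n.
Proof.
elim: n => [//|n IHn]; rewrite -addn1 iotaD map_cat /= foldl_cat.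
by move: IHn; rewrite /= => ->.
Qed.

Lemma weight_iter_convolution (g : nat -> R -> \bar R) n :
  (forall i, weight (g i) 1) -> weight (iter_convolution g n) 1.
Proof.
by move=> wg; elim: n => [|n IHn] /=; [exact: wg|exact: weight_convolution IHn (wg _)].
Qed.

Lemma majorized_iter_convolution (g : nat -> R -> \bar R) n :
  (forall i, weight (g i) 1) -> majorized (iter_convolution g n) (bspline n.+1).
Proof.
move=> wg; elim: n => [|n IHn]; first exact: majorized_box (wg 0%N).
exact: majorized_convolution (weight_iter_convolution n wg).1
  (weight_bspline n).1 IHn (wg _).
Qed.

End majorization.

(** * Existence of the rearrangement *)

Section rearrangements.
Context {R : realType}.
Implicit Types (f h G M : R -> \bar R) (l r : R).

Local Notation superlevel f l := [set x : lebesgueType R | l%:E < f x].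

Lemma measurable_superlevel f l : lebesgue_measurable f ->
  measurable (superlevel f l).
Proof.
by move=> mf; rewrite -[X in measurable X]setTI; exact: emeasurable_fun_o_infty.
Qed.

(** The centered open interval of length [t], written so as to include the whole
    line for [t = +oo]. *)
Definition measured_ball (t : \bar R) : set R := [set x | (2 * `|x|)%:E < t].

Lemma measured_ball_fin r : measured_ball r%:E = `](- (r / 2))%R, (r / 2)%R[%classic.
Proof.
apply/seteqP; split=> x; rewrite /measured_ball /= lte_fin in_itv/= -ltr_norml; lra.
Qed.

Lemma measured_ballP t : 0 <= t ->
  @measurable _ (measurableTypeR R) (measured_ball t) /\
  lebesgue (measured_ball t) = t.
Proof.
case: t => [r| |//].
- rewrite lee_fin measured_ball_fin => r0.
  have mr : @measurable _ (measurableTypeR R) `](- (r / 2))%R, (r / 2)%R[%classic.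
    exact: measurable_itv.
  split=> //; rewrite (completed_borel_set mr).2 lebesgue_measure_itv/= lte_fin -EFinB.
  by case: ltP => rr; congr EFin; lra.
- move=> _; have -> : measured_ball +oo = [set` `]-oo, +oo[].
    by rewrite set_itvNyy; apply/seteqP; split=> x // _; rewrite /measured_ball /= ltry.
  have mT : @measurable _ (measurableTypeR R) [set` `]-oo, +oo[].
    exact: measurable_itv.
  by split=> //; rewrite (completed_borel_set mT).2 lebesgue_measure_itv.
Qed.

(** A superlevel set is the increasing union of the superlevel sets of slightly
    higher levels, so the measure of superlevel sets is right-continuous in the
    level. *)
Lemma superlevel_right_cvg f l (t : \bar R) : lebesgue_measurable f ->
  t < lebesgue (superlevel f l) ->
  exists2 l' : R, (l < l')%R & t < lebesgue (superlevel f l').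
Proof.
move=> mf tf; pose A n := superlevel f (l + n.+1%:R^-1)%R.
have Acvg : (lebesgue \o A) n @[n --> \oo] --> lebesgue (\bigcup_n A n).
  apply: nondecreasing_cvg_mu => //.
  - by move=> n; exact: measurable_superlevel.
  - by apply: bigcupT_measurable => n; exact: measurable_superlevel.
  - move=> m n mn; rewrite subsetEset => x /=; apply: le_lt_trans.
    by rewrite lee_fin lerD2l lef_pV2 ?posrE// ler_nat.
have AE : \bigcup_n A n = superlevel f l.
  apply/seteqP; split=> [x [n _]|x] /=.
    by apply: lt_trans; rewrite lte_fin ltrDl invr_gt0.
  move=> lfx; have [b lb bf] : exists2 b, (l < b)%R & b%:E <= f x.
    case: (f x) lfx => [b|_|//]; first by rewrite lte_fin; exists b.
    by exists (l + 1)%R; rewrite ?ltrDl// leey.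
  have bl0 : (0 < b - l)%R by rewrite subr_gt0.
  exists (Num.truncn (b - l)^-1) => //=; apply: lt_le_trans bf.
  rewrite lte_fin -ltrBrDl invf_plt ?posrE//.
  exact: Num.Theory.truncnS_gt.
apply: contrapT => /forall2NP noA.
move: tf; rewrite -AE -(cvg_lim _ Acvg)// ltNge => /negP; apply.
apply: lime_le; first by apply/cvg_ex; eexists; exact: Acvg.
apply: nearW => n; rewrite leNgt; apply/negP => tA.
have [|//] := noA (l + n.+1%:R^-1)%R.
by rewrite ltrDl invr_gt0 ltr0n.
Qed.

(** At [x], the rearrangement is the supremum of the levels [l] for which the
    superlevel set of [h] is longer than [2 * |x|].  By right-continuity this
    supremum exceeds [l] exactly when [l] is such a level, so that the superlevel
    sets are centered open intervals of the right length. *)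
Lemma rearrangementP h : lebesgue_measurable h -> (forall x, 0 <= h x) ->
  symmetrically_decreasing (rearrangement h) /\ equimeasurable h (rearrangement h).
Proof.
move=> mh h0.
pose S (x : R) := [set l%:E | l in [set l : R |
  (0 <= l)%R /\ (2 * `|x|)%:E < lebesgue (superlevel h l)]].
(* The maximum with 0 is for an empty [S x], whose supremum is [-oo]. *)
pose hs x := maxe 0 (ereal_sup (S x)).
have hs_gt x l : (0 <= l)%R ->
    (l%:E < hs x) = ((2 * `|x|)%:E < lebesgue (superlevel h l)).
  move=> l0; apply/idP/idP.
    have l_lt0 : (l%:E < 0) = false by apply/negbTE; rewrite -leNgt lee_fin.
    rewrite /hs lt_max l_lt0/= => /ereal_sup_gt[_ [l' [l'0 xl'] <-]].
    rewrite lte_fin => ll'; apply: (lt_le_trans xl').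
    apply: le_measure; rewrite ?inE; [exact: measurable_superlevel..|].
    by move=> y /=; apply: lt_trans; rewrite lte_fin.
  move=> /(superlevel_right_cvg mh)[l' ll' xl'].
  rewrite /hs lt_max; apply/orP; right.
  apply: (@lt_le_trans _ _ l'%:E); first by rewrite lte_fin.
  by apply: ereal_sup_ubound; exists l' => //; split=> //; rewrite (le_trans l0)// ltW.
apply: (@getPex _ [set fs | symmetrically_decreasing fs /\ equimeasurable h fs]).
exists hs; split; first split.
- by move=> x; rewrite /hs le_max lexx.
- by move=> x; rewrite /hs /S normrN.
- move=> x y x0 xy; rewrite /hs ge_max le_max lexx/= le_max; apply/orP; right.
  apply: ereal_sup_le => _ [l [l0 yl] <-]; exists l => //; split=> //.
  apply: le_lt_trans yl; rewrite lee_fin.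
  by rewrite !gtr0_norm ?(lt_trans x0 xy)// ler_pM2l// ltW.
have hs_level l : (0 <= l)%R ->
    superlevel hs l = measured_ball (lebesgue (superlevel h l)).
  by move=> l0; apply/seteqP; split=> x; rewrite /= hs_gt.
split=> //.
- apply: (measurability _ (ErealGenOInfty.measurableE R)) => // _ [_ [a ->] <-].
  rewrite setTI; have [a0|a0] := leP 0%R a.
    rewrite (_ : _ @^-1` _ = superlevel hs a).
      rewrite hs_level//; apply: (completed_borel_set _).1.
      by apply: (measured_ballP _).1; exact: measure_ge0.
    by apply/seteqP; split=> x /=; rewrite in_itv/= andbT.
  rewrite (_ : _ @^-1` _ = setT); first exact: measurableT.
  apply/seteqP; split=> x //= _; rewrite in_itv/= andbT.
  by apply: (@lt_le_trans _ _ 0); rewrite ?lte_fin// /hs le_max lexx.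
- by move=> l l0; rewrite hs_level// (measured_ballP _).2.
Qed.

End rearrangements.

(** * From superlevel sets to functions *)

Section layer_cake.
Context {R : realType}.
Implicit Types (f h G M : R -> \bar R) (l r : R).

(** Restricting to nonnegative levels makes [f x] the length of the set of levels
    whose layer contains [x]. *)
Definition layer f l : set R := [set x | (0 <= l)%R /\ l%:E < f x].

Lemma integral_layer f x : 0 <= f x ->
  \int[mu]_l (\1_(layer f l) x)%:E = f x.
Proof.
move=> fx0; transitivity (\int[mu]_l
    (\1_([set l : R | (0 <= l)%R /\ (l%:E < f x)%E]) l)%:E).
  by apply: eq_integral => l _; rewrite !indicE; congr ((nat_of_bool _)%:R%:E);
    apply/idP/idP; rewrite !inE.
case: (f x) fx0 => [r| |//].
- rewrite lee_fin => r0; have -> : [set l : R | (0 <= l)%R /\ l%:E < r%:E] =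
      [set` `[0%R, r[].
    by apply/seteqP; split=> l /=; rewrite lte_fin in_itv/= => /andP.
  rewrite integral_indic; [|exact: measurableT|exact: measurable_itv].
  rewrite setIT /= lebesgue_measure_itv/= lte_fin -EFinB subr0.
  by case: ltP => // r_le0; congr EFin; apply/le_anti; rewrite r0 r_le0.
- move=> _; have -> : [set l : R | (0 <= l)%R /\ l%:E < +oo] =
      [set` `[0%R, +oo[].
    by apply/seteqP; split=> l /=; rewrite ltry in_itv/= andbT; [case|].
  rewrite integral_indic; [|exact: measurableT|exact: measurable_itv].
  by rewrite setIT /= lebesgue_measure_itv/= ltry.
Qed.

Definition layer_kernel f M (p : lebesgueType R * measurableTypeR R) : \bar R :=
  (\1_(layer f p.2) (p.1 : R))%:E * M (p.1 : R).

Lemma layer_kernel_ge0 f M p : nnborel M -> 0 <= layer_kernel f M p.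
Proof. by move=> [_ M0]; rewrite /layer_kernel mule_ge0// lee_fin. Qed.

(** The condition [l < f x] is equivalent to [0 < f x - l], also for infinite
    values of [f]. *)
Lemma measurable_layers f : lebesgue_measurable f ->
  measurable [set p : lebesgueType R * measurableTypeR R | layer f p.2 p.1].
Proof.
move=> mf; rewrite [X in measurable X](_ : _ =
    ([set: lebesgueType R] `*` `[0%R, +oo[%classic) `&`
    [set p : lebesgueType R * measurableTypeR R | 0 < f p.1 - p.2%:E]).
  apply: measurableI; first by apply: measurableX => //; exact: measurable_itv.
  rewrite -[X in measurable X]setTI; apply: emeasurable_fun_o_infty => //.
  apply: emeasurable_funB; first by apply: (measurableT_comp mf); exact: measurable_fst.
  by apply/measurable_EFinP; exact: measurable_snd.
apply/seteqP; split=> -[x l]; rewrite /layer /= in_itv/= andbT.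
  by move=> [l0 lf]; rewrite EFinN sube_gt0.
by move=> [[_ l0]]; rewrite EFinN sube_gt0.
Qed.

Lemma measurable_layer_kernel f M : lebesgue_measurable f -> nnborel M ->
  measurable_fun setT (layer_kernel f M).
Proof.
move=> mf [mM _]; apply: emeasurable_funM.
  have mB1 : measurable_fun setT
      (EFin \o \1_[set p : lebesgueType R * measurableTypeR R | layer f p.2 p.1]
       : _ -> \bar R).
    by apply/measurable_EFinP; apply: measurable_indic; exact: measurable_layers.
  exact: mB1.
by apply: (measurableT_comp (lebesgue_measurable_borel mM)); exact: measurable_fst.
Qed.

Lemma nnborel_layer_integral f M : lebesgue_measurable f -> nnborel M ->
  nnborel (fun l => \int[lebesgue]_x ((\1_(layer f l) x)%:E * M x)).
Proof.
move=> mf nM; have k0 p := layer_kernel_ge0 f p nM; split.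
  exact: (@measurable_fun_fubini_tonelli_G _ _ (lebesgueType R)
    (measurableTypeR R) R lebesgue _ (measurable_layer_kernel mf nM) k0).
by move=> l; apply: integral_ge0 => x _; exact: (k0 (x, l)).
Qed.

(** Tonelli's theorem, for the Lebesgue sigma-algebra in [x] and the Borel
    sigma-algebra in the level. *)
Lemma layer_cake f M : lebesgue_measurable f -> (forall x, 0 <= f x) -> nnborel M ->
  \int[lebesgue]_x (f x * M x) =
  \int[mu]_l \int[lebesgue]_x ((\1_(layer f l) x)%:E * M x).
Proof.
move=> mf f0 nM; have k0 p := layer_kernel_ge0 f p nM.
transitivity (\int[lebesgue]_x \int[mu]_l layer_kernel f M (x, l)); last first.
  exact: (@fubini_tonelli _ _ (lebesgueType R) (measurableTypeR R) R lebesgue mu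
    _ (measurable_layer_kernel mf nM) k0).
apply: eq_integral => x _; rewrite -[in LHS](integral_layer (f0 x)).
rewrite -ge0_integralZr//.
- have mB1 : measurable_fun setT
      (EFin \o \1_[set p : lebesgueType R * measurableTypeR R | layer f p.2 p.1]
       : _ -> \bar R).
    by apply/measurable_EFinP; apply: measurable_indic; exact: measurable_layers.
  exact: (measurableT_comp mB1 (@measurable_pair1 _ _ (lebesgueType R) _ x)).
- exact: nM.2.
Qed.

Lemma abs_symmetrically_decreasing f x y : symmetrically_decreasing f ->
  x != 0%R -> (`|x| < `|y|)%R -> f y <= f x.
Proof.
move=> [_ f_even f_dec] x0 xy.
have fabs z : f `|z|%R = f z by case: (ler0P z) => _; rewrite ?f_even.
by rewrite -(fabs x) -(fabs y); apply: f_dec; rewrite ?normr_gt0.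
Qed.

(** If [x] is outside the superlevel set then so are all points farther from
    the origin, and the superlevel set has length at most [2 * |x|].  The origin
    is excluded because its value is not tied to the others. *)
Lemma superlevel_symmetrically_decreasing f l x : lebesgue_measurable f ->
  symmetrically_decreasing f -> x != 0%R ->
  (2 * `|x|)%:E < lebesgue [set y : R | l%:E < f y] -> l%:E < f x.
Proof.
move=> mf sf x0; apply: contraTT; rewrite -!leNgt => fxl.
have mI : @measurable _ (measurableTypeR R) `[(- `|x|)%R, `|x|%R]%classic.
  exact: measurable_itv.
have -> : (2 * `|x|)%:E = lebesgue `[(- `|x|)%R, `|x|%R]%classic.
  rewrite (completed_borel_set mI).2 lebesgue_measure_itv/= lte_fin -EFinB.
  by rewrite gtrN ?normr_gt0//; congr EFin; ring.
apply: le_measure; rewrite ?inE.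
- exact: measurable_superlevel.
- exact: (completed_borel_set mI).1.
- move=> y /=; rewrite in_itv/= -ler_norml; apply: contraPT; rewrite -ltNge => xy.
  by apply/negP; rewrite -leNgt (le_trans _ fxl)// abs_symmetrically_decreasing.
Qed.

Lemma lebesgue_measurable_indic (A : set (lebesgueType R)) : measurable A ->
  lebesgue_measurable (EFin \o \1_A : R -> \bar R).
Proof.
move=> mA.
exact/measurable_EFinP.
Qed.

(** For [A] of finite measure, majorization applies to a Borel version of the
    indicator of [A].  For infinite measure the right-hand side is the whole mass
    of [M], which equals that of [G]. *)
Lemma majorized_level G M (A B : set (lebesgueType R)) :
  weight G 1 -> weight M 1 -> majorized G M -> measurable A -> measurable B ->
  (forall x, x != 0%R -> (2 * `|x|)%:E < lebesgue A -> B x) ->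
  \int[lebesgue]_x ((\1_A x)%:E * G x) <= \int[lebesgue]_x ((\1_B x)%:E * M x).
Proof.
move=> [uG G1] [uM M1] GM mA mB AB.
have A_ge0 : 0 <= lebesgue A by exact: measure_ge0.
have [mball ball_A] := measured_ballP A_ge0.
have nballM := nnborelM (nnborel_indic mball) uM.1.
have le_ball : \int[mu]_x ((\1_(measured_ball (lebesgue A)) x)%:E * M x) <=
    \int[lebesgue]_x ((\1_B x)%:E * M x).
  rewrite -(integral_lebesgue_borel nballM); apply: ae_ge0_le_integral.
  - exact: measurableT.
  - by move=> x _; exact: nballM.2.
  - exact: lebesgue_measurable_borel nballM.1.
  - by move=> x _; rewrite mule_ge0 ?lee_fin ?(uM.1.2).
  - apply: emeasurable_funM; first exact: lebesgue_measurable_indic.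
    exact: lebesgue_measurable_borel uM.1.1.
  - have m0 : @measurable _ (measurableTypeR R) [set 0%R] by exact: measurable_set1.
    exists [set 0%R]; split; first exact: (completed_borel_set m0).1.
      exact: etrans (completed_borel_set m0).2 (lebesgue_measure_set1 _).
    move=> x /=; apply: contra_notP => /eqP x0 _.
    apply: lee_wpmul2r; first exact: uM.1.2.
    rewrite lee_fin !indicE ler_nat; case: (boolP (x \in measured_ball _)) => //.
    by rewrite inE => /(AB _ x0) Bx; rewrite mem_set.
apply: le_trans le_ball.
have [v [nv Av v01]] : exists v, [/\ nnborel v,
    mu.-negligible [set x : measurableTypeR R | (\1_A x)%:E <> v x] &
    forall x, v x = (\1_A x)%:E \/ v x = 0].
  apply: borel_version => [|x]; last by rewrite lee_fin.
  exact: lebesgue_measurable_indic.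
have uv : subunit v.
  split=> // x; have [->|->] := v01 x; last exact: lee01.
  by rewrite lee_fin indicE; case: (_ \in _).
have -> : \int[lebesgue]_x ((\1_A x)%:E * G x) = \int[mu]_x (v x * G x).
  apply: integral_lebesgue_ae; first exact: nnborelM nv uG.1.
    by move=> x; rewrite mule_ge0 ?lee_fin ?(uG.1.2).
  by apply: negligibleS Av => x /=; apply: contra_not => ->.
have v_mass : \int[mu]_x v x = lebesgue A.
  rewrite -(integral_lebesgue_ae (f := fun x => (\1_A x)%:E) nv)//.
  by rewrite integral_indic// setIT.
case: (lebesgue A) A_ge0 v_mass {nballM mball ball_A AB} => [r| |//].
- rewrite lee_fin => r0 v_mass.
  have := GM v r (conj uv v_mass); rewrite /= (central_massE uM r0).
  by rewrite measured_ball_fin.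
- move=> _ _; apply: (@le_trans _ _ 1).
    rewrite -G1; apply: (le_integral_nnborel (nnborelM nv uG.1) uG.1) => x.
    by rewrite -[leRHS]mul1e; apply: lee_wpmul2r; [exact: uG.1.2|exact: uv.2].
  rewrite -M1; have -> : measured_ball +oo = [set: R].
    by apply/seteqP; split=> x // _; rewrite /measured_ball /= ltry.
  rewrite le_eqVlt; apply/orP; left; apply/eqP.
  by apply: eq_integral => x _; rewrite indicT mul1e.
Qed.

Lemma majorized_rearrangement G M h : weight G 1 -> weight M 1 ->
  majorized G M -> lebesgue_measurable h -> (forall x, 0 <= h x) ->
  \int[lebesgue]_x (h x * G x) <= \int[lebesgue]_x (rearrangement h x * M x).
Proof.
move=> wG wM GM mh h0.
have [sh [_ mhs hhs]] := rearrangementP mh h0; have [hs0 _ _] := sh.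
rewrite (layer_cake mh h0 wG.1.1) (layer_cake mhs hs0 wM.1.1).
have layerE f l : (0 <= l)%R -> layer f l = [set x | l%:E < f x].
  by move=> l0; apply/seteqP; split=> x //= [].
apply: (le_integral_nnborel (nnborel_layer_integral mh wG.1.1)
  (nnborel_layer_integral mhs wM.1.1)) => l.
have [l0|l0] := leP 0%R l.
  rewrite !layerE//; apply: majorized_level => //.
  - exact: measurable_superlevel.
  - exact: measurable_superlevel.
  - move=> x x0; rewrite (hhs _ l0); exact: superlevel_symmetrically_decreasing.
rewrite integral0_eq; last first.
  move=> x _; rewrite indicE memNset ?mul0e// => -[].
  by rewrite leNgt l0.
by apply: integral_ge0 => x _; rewrite mule_ge0 ?lee_fin ?(wM.1.1.2).
Qed.

End layer_cake.

(** * Essential supports of convolutions *)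

Section tails.
Context {R : realType}.
Implicit Types (f g : R -> \bar R) (a b p q s t : R).

Definition tail f t := \int[mu]_(x in `]t, +oo[) f x.

Lemma tailE f t : nnborel f ->
  tail f t = \int[mu]_x (itv_indic `]t, +oo[ x * f x).
Proof.
move=> nf; rewrite /tail -integral_indicM; last exact: measurable_itv.
by apply: eq_integral => x _; rewrite muleC.
Qed.

Lemma tail_ge0 f t : nnborel f -> 0 <= tail f t.
Proof. by move=> [_ f0]; apply: integral_ge0. Qed.

Lemma tail_nonincreasing f s t : nnborel f -> (s <= t)%R -> tail f t <= tail f s.
Proof.
move=> [mf f0] st; apply: ge0_subset_integral => //; first exact: measurable_funS mf.
by apply: subset_itvr; rewrite bnd_simp.
Qed.

(** The half-line [x > t] is the increasing union of the half-lines [x > s] with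
    [s > t]. *)
Lemma tail_right_continuous f t : nnborel f ->
  (forall s, (t < s)%R -> tail f s = 0) -> tail f t = 0.
Proof.
move=> nf ft0; apply/le_anti; rewrite tail_ge0// andbT leNgt; apply/negP => ft.
have [|||n] := @nnborel_bigcup_gt R f
    (fun n => `](t + n.+1%:R^-1)%R, +oo[%classic) 0 nf.
- move=> m n mn; rewrite subsetEset; apply: subset_itvr.
  by rewrite bnd_simp lerD2l lef_pV2 ?posrE// ler_nat.
- by [].
- rewrite (_ : \bigcup_n _ = `]t, +oo[%classic)//.
  apply/seteqP; split=> [x [n _]|x]; rewrite /= !in_itv/= !andbT.
    by apply: lt_trans; rewrite ltrDl invr_gt0 ltr0n.
  rewrite -subr_gt0 => tx; exists (Num.truncn (x - t)^-1) => //=.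
  rewrite in_itv/= andbT -ltrBrDl invf_plt ?posrE//.
  exact: Num.Theory.truncnS_gt.
- by rewrite -/(tail f _) ft0 ?ltxx// ltrDl invr_gt0 ltr0n.
Qed.

(** If [y > t] and [x - y > s] then [x > s + t]; hence the convolution of the two
    truncated functions vanishes for [x <= s + t], while its integral is the
    product on the left. *)
Lemma tail_convolution f g s t : nnborel f -> nnborel g ->
  tail f s * tail g t <= tail (convolution f g) (s + t).
Proof.
move=> nf ng; have nc := nnborel_convolution nf ng.
have ni := @nnborel_itv_indic R.
have nfs := nnborelM (ni `]s, +oo[) nf; have ngt := nnborelM (ni `]t, +oo[) ng.
have ncst := nnborel_convolution nfs ngt.
rewrite (tailE _ nf) (tailE _ ng) (tailE _ nc) -(integral_convolution nfs ngt).
apply: (le_integral_nnborel ncst (nnborelM (ni _) nc)) => x.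
have nfx := nnborel_affine_comp x true nf.
have nfsx := nnborel_affine_comp x true nfs.
rewrite itv_indicE in_itv/= andbT; case: ltP => stx.
  rewrite mul1e !convolutionE//.
  apply: (le_integral_nnborel (nnborelM nfsx ngt) (nnborelM nfx ng)) => y.
  have le1 i z : itv_indic i z <= 1 :> \bar R by exact: (subunit_itv_indic i).2.
  apply: lee_pmul; [exact: nfsx.2|exact: ngt.2| |].
  - by rewrite -[leRHS]mul1e; apply: lee_wpmul2r; [exact: nf.2|exact: le1].
  - by rewrite -[leRHS]mul1e; apply: lee_wpmul2r; [exact: ng.2|exact: le1].
rewrite mul0e convolutionE// integral0_eq// => y _.
rewrite !itv_indicE !in_itv/= !andbT.
case: ltP => sxy; last by rewrite !mul0e.
case: ltP => ty; last by rewrite !mul0e mule0.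
by exfalso; lra.
Qed.

Lemma tail_gt0 f : nnborel f -> \int[mu]_x f x = 1 ->
  exists n : nat, 0 < tail f (- n%:R).
Proof.
move=> nf f1.
have [|||n] := @nnborel_bigcup_gt R f (fun n => `](- n%:R)%R, +oo[%classic) 0 nf.
- move=> m k mk; rewrite subsetEset; apply: subset_itvr.
  by rewrite bnd_simp lerN2 ler_nat.
- by [].
- by rewrite bigcup_right_rays f1 lte01.
- by move=> fn; exists n.
Qed.

(** The right ends of the essential supports add up: by [tail_convolution] the tail
    of [g] at [t] or that of [f] at [q - t] vanishes for every [t], and [b] is the
    infimum of the [t] for which it is the tail of [g]. *)
Lemma tail_convolution_eq0 f g q : nnborel f -> nnborel g ->
  \int[mu]_x f x = 1 -> \int[mu]_x g x = 1 -> tail (convolution f g) q = 0 ->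
  exists b, tail g b = 0 /\ tail f (q - b) = 0.
Proof.
move=> nf ng f1 g1 fgq.
have dichotomy t : tail g t = 0 \/ tail f (q - t) = 0.
  have := tail_convolution (q - t) t nf ng; rewrite subrK fgq => fg0.
  have /eqP : tail f (q - t) * tail g t = 0.
    by apply/le_anti; rewrite fg0 mule_ge0 ?tail_ge0.
  by rewrite mule_eq0 => /orP[/eqP|/eqP]; [right|left].
pose S := [set t | tail g t = 0].
have S_up s t : S s -> (s <= t)%R -> S t.
  move=> Ss st; apply/le_anti; rewrite tail_ge0// andbT.
  by apply: le_trans (tail_nonincreasing ng st) _; rewrite Ss.
have [m gm] := tail_gt0 ng g1; have [n fn] := tail_gt0 nf f1.
have S0 : S !=set0.
  exists (q + n%:R)%R; have [//|] := dichotomy (q + n%:R)%R.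
  by rewrite opprD addrA subrr add0r => fn0; rewrite fn0 ltxx in fn.
have S_lb : lbound S (- m%:R)%R.
  move=> t St; rewrite leNgt; apply/negP => /ltW /(S_up _ _ St) Sm.
  by move: gm; rewrite [tail _ _]Sm ltxx.
have hS : has_inf S by split=> //; exists (- m%:R)%R.
exists (inf S); split.
  apply: (tail_right_continuous ng) => s bs.
  have [t St ts] := inf_lt S0 bs.
  exact: S_up St (ltW ts).
apply: (tail_right_continuous nf) => s bs.
have [gS|] := dichotomy (q - s)%R; last by rewrite subKr.
have : (inf S <= q - s)%R by apply: ge_inf; [exact: hS.2|exact: gS].
by rewrite lerBrDr -lerBrDl leNgt bs.
Qed.

Definition reflection f x := f (- x)%R.

Lemma nnborel_reflection f : nnborel f -> nnborel (reflection f).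
Proof.
move=> /(nnborel_affine_comp 0 true); congr nnborel.
by apply/funext => x; rewrite add0r.
Qed.

Lemma integral_reflection f : nnborel f ->
  \int[mu]_x reflection f x = \int[mu]_x f x.
Proof.
move=> nf; rewrite -[RHS](integral_reflect 0 nf).
by apply: eq_integral => x _; rewrite sub0r.
Qed.

Lemma convolution_reflection f g : nnborel f -> nnborel g ->
  reflection (convolution f g) = convolution (reflection f) (reflection g).
Proof.
move=> nf ng; apply/funext => x.
have nfx := nnborel_affine_comp (- x)%R true nf.
rewrite (convolutionE _ (nnborel_reflection nf) (nnborel_reflection ng)).
rewrite /reflection (convolutionE _ nf ng).
rewrite -(integral_reflect 0 (nnborelM nfx ng)).
by apply: eq_integral => y _; rewrite sub0r opprK opprB addrC.
Qed.

(** The mass of [f] outside the interval from [p] to [q] is zero; the left tail is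
    expressed as the right tail of the reflected function. *)
Definition concentrated f p q := tail f q = 0 /\ tail (reflection f) (- p) = 0.

Lemma concentrated_convolution f g p q : weight f 1 -> weight g 1 ->
  concentrated (convolution f g) p q ->
  exists a b, concentrated g a b /\ concentrated f (p - a) (q - b).
Proof.
move=> [uf f1] [ug g1] [cq cp]; have nf := uf.1; have ng := ug.1.
have [b [gb fb]] := tail_convolution_eq0 nf ng f1 g1 cq.
rewrite (convolution_reflection nf ng) in cp.
have [a [ga fa]] := tail_convolution_eq0 (nnborel_reflection nf)
  (nnborel_reflection ng) (etrans (integral_reflection nf) f1)
  (etrans (integral_reflection ng) g1) cp.
exists (- a)%R, b; split; split=> //; first by rewrite opprK.
by rewrite opprB addrC.
Qed.

Lemma concentrated_mass g a b : weight g 1 -> concentrated g a b ->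
  \int[mu]_x (itv_indic `[a, b] x * g x) = 1.
Proof.
move=> [ug g1] [gb ga]; have ng := ug.1.
have ni := @nnborel_itv_indic R.
have ngr := nnborel_reflection ng.
apply/le_anti/andP; split.
  rewrite -g1; apply: (le_integral_nnborel (nnborelM (ni _) ng) ng) => x.
  rewrite -[leRHS]mul1e; apply: lee_wpmul2r; first exact: ng.2.
  exact: (subunit_itv_indic _).2.
have left_tail : \int[mu]_x (itv_indic `]-oo, a[ x * g x) = 0.
  rewrite -ga (tailE _ ngr) -(integral_reflect 0 (nnborelM (ni _) ng)).
  apply: eq_integral => x _; rewrite !itv_indicE !in_itv/= sub0r andbT.
  by rewrite -[(_ < a)%R]ltrN2 opprK.
have right_tail : \int[mu]_x (itv_indic `]b, +oo[ x * g x) = 0 by rewrite -tailE.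
have -> : \int[mu]_x (itv_indic `[a, b] x * g x) =
    \int[mu]_x (itv_indic `[a, b] x * g x) + \int[mu]_x (itv_indic `]-oo, a[ x * g x)
    + \int[mu]_x (itv_indic `]b, +oo[ x * g x).
  by rewrite left_tail right_tail !adde0.
rewrite -g1.
rewrite -(integral_nnborelD (nnborelM (ni _) ng) (nnborelM (ni _) ng)).
rewrite -(integral_nnborelD (nnborelD (nnborelM (ni _) ng) (nnborelM (ni _) ng))
   (nnborelM (ni _) ng)).
apply: (le_integral_nnborel ng).
  exact: nnborelD (nnborelD (nnborelM (ni _) ng) (nnborelM (ni _) ng)) (nnborelM (ni _) ng).
move=> x.
have ge0 i : 0 <= itv_indic i x :> \bar R by exact: (ni i).2.
rewrite -!ge0_muleDl ?adde_ge0 ?ge0// -[leLHS]mul1e.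
apply: lee_wpmul2r; first exact: ng.2.
rewrite !itv_indicE !in_itv/= -!EFinD lee_fin -!natrD ler1n.
rewrite andbT.
by case: (leP a x); case: (leP x b).
Qed.

(** A density with values in [0, 1] has at most the mass [b - a] on an interval of
    length [b - a]. *)
Lemma concentrated_length g a b : weight g 1 -> concentrated g a b -> (1 <= b - a)%R.
Proof.
move=> wg cg; have := concentrated_mass wg cg; have [ug _] := wg; have ng := ug.1.
have [ab|ba] := leP a b; last first.
  rewrite integral0_eq => [/esym/eqP|x _]; first by rewrite onee_eq0.
  rewrite itv_indicE in_itv/=; case: (boolP (_ && _)) => [xab|_]; last exact: mul0e.
  by exfalso; lra.
have [ui mi] := weight_itv_indic true false ab.
move=> gab; rewrite -lee_fin -mi -gab.
apply: (le_integral_nnborel (nnborelM ui.1 ng) ui.1) => x.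
by rewrite -[leRHS]mule1; apply: lee_wpmul2l; [exact: ui.1.2|exact: ug.2].
Qed.

Definition unit_interval_mass g := exists a, \int[mu]_x (itv_indic `[a, (a + 1)%R] x * g x) = 1.

(** Each of the [n + 1] factors needs a length of at least 1, and their lengths add
    up to at most [q - p]. *)
Lemma concentrated_iter_convolution (g : nat -> R -> \bar R) n p q :
  (forall i, weight (g i) 1) -> concentrated (iter_convolution g n) p q ->
  (n.+1%:R <= q - p)%R /\
  ((q - p <= n.+1%:R)%R -> forall i, (i <= n)%N -> unit_interval_mass (g i)).
Proof.
move=> wg; elim: n p q => [|n IHn] p q /=.
  move=> cg; have len := concentrated_length (wg 0%N) cg; split=> // qp i.
  rewrite leqn0 => /eqP->; exists p; rewrite -(concentrated_mass (wg 0%N) cg).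
  by have -> : (p + 1 = q)%R by lra.
move=> /(concentrated_convolution (weight_iter_convolution n wg) (wg _)).
move=> [a [b [cg cG]]]; have len := concentrated_length (wg n.+1) cg.
have [lenG IH] := IHn _ _ cG.
have nS : (n.+2%:R = n.+1%:R + 1 :> R)%R by rewrite natr1.
rewrite nS; split; first by lra.
move=> qp i; rewrite leq_eqVlt => /predU1P[->|]; last by rewrite ltnS; apply: IH; lra.
exists a; rewrite -(concentrated_mass (wg n.+1) cg).
by have -> : (a + 1 = b)%R by lra.
Qed.

End tails.

(** * Functions with the superlevel sets of an indicator *)

Section two_valued_levels.
Context {R : realType}.
Implicit Types (f g h G : R -> \bar R) (l c : R).

(** The superlevel set contains all points closer to the origin than [x], with
    the possible exception of the origin. *)
Lemma superlevel_ge f l x : lebesgue_measurable f -> symmetrically_decreasing f ->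
  l%:E < f x -> (2 * `|x|)%:E <= lebesgue [set y : R | l%:E < f y].
Proof.
move=> mf sf lfx; have mB := measurable_superlevel l mf.
have [->|x0] := eqVneq x 0%R; first by rewrite normr0 mulr0.
have mI : @measurable _ (measurableTypeR R) `](- `|x|)%R, `|x|%R[%classic.
  exact: measurable_itv.
have m0 : @measurable _ (measurableTypeR R) [set 0%R] by exact: measurable_set1.
have [m0' l0] := completed_borel_set m0.
have -> : (2 * `|x|)%:E = lebesgue `](- `|x|)%R, `|x|%R[%classic.
  rewrite (completed_borel_set mI).2 lebesgue_measure_itv/= lte_fin -EFinB.
  by rewrite gtrN ?normr_gt0//; congr EFin; ring.
apply: (@le_trans _ _ (lebesgue ([set y : lebesgueType R | l%:E < f y] `|` [set 0%R]))).
  apply: le_measure; rewrite ?inE.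
  - exact: (completed_borel_set mI).1.
  - exact: measurableU.
  - move=> y /=; rewrite in_itv/= -ltr_norml => yx.
    have [->|y0] := eqVneq y 0%R; [by right|left].
    exact: lt_le_trans lfx (abs_symmetrically_decreasing sf y0 yx).
have -> : lebesgue [set y : R | l%:E < f y] =
    lebesgue [set y : R | l%:E < f y] + lebesgue [set 0%R].
  by rewrite [X in _ + X](etrans l0 (lebesgue_measure_set1 _)) adde0.
exact: measureU2.
Qed.

(** The measures of the superlevel sets of an indicator of a set of measure [c]. *)
Definition box_levels c f :=
  (forall l, (0 <= l < 1)%R -> lebesgue [set y : R | l%:E < f y] = c%:E) /\
  (forall l, (1 <= l)%R -> lebesgue [set y : R | l%:E < f y] = 0).

Lemma lebesgue_null_set1 a : lebesgue.-negligible [set a : lebesgueType R].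
Proof.
have ma : @measurable _ (measurableTypeR R) [set a] by exact: measurable_set1.
have [ma' a0] := completed_borel_set ma.
by apply/negligibleP => //; exact: etrans a0 (lebesgue_measure_set1 _).
Qed.

(** Equality can fail only at the origin and at the two end points of the
    interval. *)
Lemma symmetrically_decreasing_box f c : lebesgue_measurable f ->
  symmetrically_decreasing f -> box_levels c f ->
  lebesgue.-negligible [set x : lebesgueType R | f x <> box c x].
Proof.
move=> mf sf [lev0 lev1]; have [f0 _ _] := sf.
apply: (negligibleS _ (negligibleU (lebesgue_null_set1 0%R)
  (negligibleU (lebesgue_null_set1 (c / 2)%R) (lebesgue_null_set1 (- (c / 2))%R)))).
move=> x /=; apply: contra_notP => /not_orP[/eqP x0 /not_orP[/eqP xc /eqP xNc]].
rewrite boxE; case: (ltP `|x|%R (c / 2)%R) => xlt.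
  apply/le_anti/andP; split.
    rewrite leNgt; apply/negP => /(superlevel_ge mf sf).
    by rewrite lev1// lee_fin pmulr_rle0// normr_le0 (negbTE x0).
  apply/lee_addgt0Pr => e e0; rewrite -leeBlDr// -EFinB.
  have [e1|e1] := leP 1%R e.
    by apply: le_trans (f0 x); rewrite lee_fin subr_le0.
  apply/ltW/(superlevel_symmetrically_decreasing mf sf x0).
  have l01 : (0 <= 1 - e < 1)%R by lra.
  by rewrite (lev0 _ l01) lte_fin; lra.
apply/le_anti; rewrite f0 andbT leNgt; apply/negP => /(superlevel_ge mf sf).
rewrite lev0 ?lexx ?ltr01// lee_fin => xle.
have xe : (`|x| = c / 2)%R by lra.
by move: xe; case: (ler0P x) => _ xe; move: xc xNc; rewrite -xe ?opprK eqxx.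
Qed.

Lemma rearrangement_box h c : lebesgue_measurable h -> (forall x, 0 <= h x) ->
  box_levels c h ->
  lebesgue.-negligible [set x : lebesgueType R | rearrangement h x <> box c x].
Proof.
move=> mh h0 [lev0 lev1]; have [sh [_ mhs hhs]] := rearrangementP mh h0.
apply: symmetrically_decreasing_box => //; split=> l l01.
- by rewrite -hhs ?lev0//; case/andP: l01.
- by rewrite -hhs ?lev1// (le_trans _ l01).
Qed.

Lemma symmetrically_decreasing_of_box c : symmetrically_decreasing (box c : R -> \bar R).
Proof.
split=> [x|x|x y x0 xy]; rewrite !boxE.
- by rewrite lee_fin.
- by rewrite normrN.
- rewrite lee_fin ler_nat !gtr0_norm ?(lt_trans x0 xy)//.
  by case: (ltP y (c / 2)%R) => // yc; rewrite (lt_trans xy yc).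
Qed.

Lemma box_levels_box c : (0 <= c)%R -> box_levels c (box c).
Proof.
move=> c0; split=> l l1.
  rewrite (_ : [set y | _] = measured_ball c%:E); first by apply: (measured_ballP _).2.
  rewrite measured_ball_fin; apply/seteqP; split=> x /=; rewrite boxE lte_fin in_itv/= -ltr_norml.
    by case: (ltP `|x|%R (c / 2)%R) => //= _; lra.
  by move=> -> /=; lra.
rewrite (_ : [set y | _] = set0) ?measure0//.
apply/seteqP; split=> x //=; rewrite boxE lte_fin.
by case: (ltP `|x|%R (c / 2)%R) => /= _; lra.
Qed.

(** On the interval [1 - g] is nonnegative with integral zero, and so is [g] outside
    of it. *)
Lemma unit_interval_mass_indic g a : weight g 1 ->
  \int[mu]_x (itv_indic `[a, (a + 1)%R] x * g x) = 1 ->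
  mu.-negligible [set x : measurableTypeR R | g x <> itv_indic `[a, (a + 1)%R] x].
Proof.
move=> [ug g1] gI; have ng := ug.1; have [mg g0] := ng.
set I : interval R := `[a, (a + 1)%R] in gI *.
have mI : @measurable _ (measurableTypeR R) [set` I] by exact: measurable_itv.
have g_fin x : g x \is a fin_num.
  by rewrite ge0_fin_numE// (le_lt_trans (ug.2 x))// ltry.
have nI := nnborel_itv_indic I.
have nIC : nnborel (EFin \o \1_(~` [set` I]) : R -> \bar R).
  by apply: nnborel_indic; exact: measurableC.
have n1g : nnborel (fun x => 1 - g x).
  split; first exact: emeasurable_funB.
  by move=> x; rewrite sube_ge0 ?g_fin ?orbT//; exact: ug.2.
have nin := nnborelM nI n1g; have nout := nnborelM nIC ng.
have inside : \int[mu]_x (itv_indic I x * (1 - g x)) = 0.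
  have aI : \int[mu]_x itv_indic I x = 1.
    have [_] : weight (itv_indic I) (a + 1 - a)%R.
      by apply: weight_itv_indic; rewrite lerDl.
    by rewrite addrAC subrr add0r.
  have : \int[mu]_x (itv_indic I x * (1 - g x))
      + \int[mu]_x (itv_indic I x * g x) = 1.
    rewrite -(integral_nnborelD nin (nnborelM nI ng)) -[RHS]aI.
    apply: eq_integral => x _; rewrite -ge0_muleDr ?(n1g.2)//.
    by rewrite subeK// mule1.
  by rewrite gI => /(congr1 (fun t => t - 1)); rewrite addeK// subee.
have outside : \int[mu]_x ((EFin \o \1_(~` [set` I])) x * g x) = 0.
  have := integral_setC_split mI ng; rewrite g1.
  have -> : \int[mu]_x (g x * (\1_[set` I] x)%:E) = 1.
    by rewrite -gI; apply: eq_integral => x _; rewrite muleC.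
  move=> /(congr1 (fun t => t - 1)); rewrite subee// addeAC subee// add0e => ->.
  by apply: eq_integral => x _; rewrite muleC.
have nD := nnborelD nin nout.
have /(ae_eq_integral_abs mu measurableT nD.1) : \int[mu]_x
    `|itv_indic I x * (1 - g x) + (EFin \o \1_(~` [set` I])) x * g x| = 0.
  rewrite -[RHS]adde0 -{1}inside -outside -(integral_nnborelD nin nout).
  by apply: eq_integral => x _; rewrite gee0_abs// nD.2.
move=> [N [mN N0 DN]]; exists N; split=> // x /= gx; apply: DN => /= /(_ Logic.I).
rewrite itv_indicE /= indicE in_setC mem_setE; move: gx; rewrite itv_indicE.
case: (x \in I) => /= gx; rewrite ?mul1e ?mul0e ?adde0 ?add0e//.
by move=> /eqP; rewrite sube_eq// ?add0e => /eqP g_eq1; apply: gx.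
Qed.

End two_valued_levels.

(** * The inequality and its case of equality *)

Section extremal.
Context {R : realType}.
Implicit Types (f h G M : R -> \bar R).

Lemma bspline_support n x : (n.+1%:R / 2 <= `|x|)%R ->
  bspline n.+1 x = 0 :> \bar R.
Proof.
elim: n x => [|n IHn] x nx; first by rewrite -[bspline 1]/(box 1) boxE ltNge nx.
have nb : nnborel (box 1 : R -> \bar R) by exact: nnborel_itv_indic.
rewrite bsplineS (convolutionE _ (weight_bspline n).1.1 nb).
apply: integral0_eq => y _; rewrite boxE; case: ltP => y1; last by rewrite mule0.
rewrite IHn ?mul0e//; have := ler_normB x y.
have nS : (n.+2%:R = n.+1%:R + 1 :> R)%R by rewrite natr1.
have := lerB_dist x y; move: nx; rewrite nS; lra.
Qed.

(** The whole mass of [G] is already attained on the interval. *)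
Lemma box_mass_tail_eq0 G c : weight G 1 -> \int[mu]_x (box c x * G x) = 1 ->
  tail G (c / 2) = 0.
Proof.
move=> [[nG _] G1] boxG; apply/le_anti; rewrite tail_ge0// andbT.
have ni := @nnborel_itv_indic R.
have nb : nnborel (box c : R -> \bar R) by exact: ni.
have : \int[mu]_x (box c x * G x) + tail G (c / 2) <= 1.
  rewrite (tailE _ nG) -(integral_nnborelD (nnborelM nb nG) (nnborelM (ni _) nG)) -G1.
  apply: (le_integral_nnborel (nnborelD (nnborelM nb nG) (nnborelM (ni _) nG)) nG) => x.
  rewrite -ge0_muleDl ?(nb.2) ?((ni _).2)// -[leRHS]mul1e.
  apply: lee_wpmul2r; first exact: nG.2.
  rewrite boxE itv_indicE in_itv/= andbT -EFinD lee_fin -natrD lern1.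
  case: (ltP (c / 2)%R x) => cx; last by rewrite addn0; case: (_ < _)%R.
  by rewrite ltNge (le_trans (ltW cx)) ?ler_norm.
by rewrite boxG -[leRHS]adde0 leeD2lE.
Qed.

Lemma box_mass_concentrated G c : weight G 1 -> \int[mu]_x (box c x * G x) = 1 ->
  concentrated G (- (c / 2)) (c / 2).
Proof.
move=> wG boxG; have nG := wG.1.1; split; first exact: box_mass_tail_eq0.
have nr := nnborel_reflection nG.
have nb : nnborel (box c : R -> \bar R) by exact: nnborel_itv_indic.
rewrite opprK; apply: box_mass_tail_eq0.
  split; last by rewrite integral_reflection// wG.2.
  by split=> // x; exact: wG.1.2.
rewrite -boxG -(integral_reflect 0 (nnborelM nb nG)).
by apply: eq_integral => x _; rewrite !boxE sub0r normrN.
Qed.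

(** For [n > 0] the two convolutions agree at every point, so that a null set is
    needed only for [n = 0]. *)
Lemma iter_convolution_ae (f g : nat -> R -> \bar R) n :
  (forall i x, 0 <= f i x) -> (forall i, nnborel (g i)) ->
  (forall i, mu.-negligible [set x : measurableTypeR R | f i x <> g i x]) ->
  (forall x, 0 <= iter_convolution f n x) /\
  mu.-negligible
    [set x : measurableTypeR R | iter_convolution f n x <> iter_convolution g n x].
Proof.
move=> f0 ng fg; elim: n => [|n [IH0 IHn]] //=.
have nG m : nnborel (iter_convolution g m).
  by elim: m => //= m IHm; exact: nnborel_convolution.
split.
  by move=> x; apply: integral_ge0 => y _; rewrite mule_ge0.
rewrite (eq_convolution_ae (nG n) (ng n.+1) IH0 (f0 n.+1) IHn (fg n.+1)).
by apply: negligibleS (negligible_set0 mu) => x /=.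
Qed.

Lemma integralM_ae h f f0 : lebesgue_measurable h -> (forall x, 0 <= h x) ->
  (forall x, 0 <= f x) -> nnborel f0 ->
  mu.-negligible [set x : measurableTypeR R | f x <> f0 x] ->
  \int[lebesgue]_x (h x * f x) = \int[lebesgue]_x (h x * f0 x).
Proof.
move=> mh h0 f_ge0 nf0 ff0; apply: ge0_ae_eq_integral.
- exact: measurableT.
- exact: emeasurable_funM mh (ae_lebesgue_measurable nf0 ff0).
- exact: emeasurable_funM mh (lebesgue_measurable_borel nf0.1).
- by move=> x _; exact: mule_ge0.
- by move=> x _; apply: mule_ge0 => //; exact: nf0.2.
- have [N [mN N0 fN]] := null_set_lebesgue ff0.
  by exists N; split=> // x /= xN; apply: fN => /= fx; apply: xN => _; rewrite fx.
Qed.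

Lemma box_levels_indicator f a : lebesgue_measurable f ->
  mu.-negligible [set x : measurableTypeR R | f x <> itv_indic `[a, (a + 1)%R] x] ->
  (forall x, f x <= 1) -> box_levels 1 f.
Proof.
move=> mf fI f1; split=> l l1; last first.
  rewrite (_ : [set y | _] = set0) ?measure0//; apply/seteqP; split=> x //=.
  by rewrite ltNge (le_trans (f1 x))// lee_fin.
have mA := measurable_superlevel l mf.
have [uI mI] : weight (itv_indic `[a, (a + 1)%R]) (a + 1 - a)%R.
  by apply: weight_itv_indic; rewrite lerDl.
rewrite addrAC subrr add0r in mI; rewrite -[RHS]mI.
set A := [set y | _] in mA *.
transitivity (\int[lebesgue]_x (\1_A x)%:E).
  by rewrite integral_indic// setIT.
apply: integral_lebesgue_ae; first exact: uI.1.
  by move=> x; rewrite lee_fin.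
apply: negligibleS fI => x /=; apply: contra_not => fx.
rewrite itv_indicE indicE; congr ((nat_of_bool _)%:R%:E).
have -> : (x \in A) = (l%:E < f x).
  by apply/idP/idP; rewrite inE.
rewrite fx itv_indicE lte_fin; case/andP: l1.
case: (x \in _) => /= l_ge0 l_lt1; first exact: l_lt1.
by apply/negbTE; rewrite -leNgt.
Qed.

End extremal.

Theorem theorem3p2 (R : realType) (n : nat) (hn : (1 <= n)%N)
    (g : 'I_n -> R -> R)
    (gmeas : forall j, lebesgue_measurable (g j))
    (g01 : forall j x, (0 <= g j x <= 1)%R)
    (gint : forall j, \int[lebesgue]_x (g j x)%:E = 1) :
  let G := convolutions [seq EFin \o g j | j <- enum 'I_n] in
  (forall h : R -> \bar R,
     lebesgue_measurable h -> (forall x, 0 <= h x) ->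
     \int[lebesgue]_x (h x * G x)
       <= \int[lebesgue]_x (rearrangement h x * bspline n x)) /\
  ((forall h : R -> \bar R, symmetrically_decreasing h ->
      \int[lebesgue]_x (h x * G x)
        = \int[lebesgue]_x (rearrangement h x * bspline n x)) ->
   forall j, {ae lebesgue, forall x : R,
     rearrangement (EFin \o g j) x = bspline 1 x}).
Proof.
case: n hn g gmeas g01 gint => // n _ g gmeas g01 gint.
pose F i : R -> \bar R := EFin \o g (inord i).
have mF i : lebesgue_measurable (F i).
  by apply/measurable_EFinP; exact: gmeas.
have F0 i x : 0 <= F i x by rewrite lee_fin; case/andP: (g01 (inord i) x).
have F1 i x : F i x <= 1 by rewrite lee_fin; case/andP: (g01 (inord i) x).
have [b bP] := choice (fun i => borel_version (mF i) (F0 i)).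
have nb i : nnborel (b i) by have [] := bP i.
have Fb i : mu.-negligible [set x : measurableTypeR R | F i x <> b i x].
  by have [] := bP i.
have wb i : weight (b i) 1.
  split; last by rewrite -(integral_lebesgue_ae (nb i) (F0 i) (Fb i)); exact: gint.
  split=> // x; have [_ _ /(_ x)] := bP i.
  by case=> ->; [exact: F1|exact: lee01].
have -> : convolutions [seq EFin \o g j | j <- enum 'I_n.+1] = iter_convolution F n.
  rewrite -convolutions_iota -val_enum_ord -map_comp; congr convolutions.
  by apply: eq_map => j; rewrite /F /= inord_val.
have [GF0 GFb] := iter_convolution_ae n F0 nb Fb.
have wG := weight_iter_convolution n wb.
have wM := weight_bspline n : weight (bspline n.+1 : R -> \bar R) 1.
have GM := majorized_iter_convolution n wb.
split=> [h mh h0|extremal j].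
  rewrite (integralM_ae mh h0 GF0 wG.1.1 GFb).
  exact: majorized_rearrangement.
pose c : R := n.+1%:R.
have c0 : (0 <= c)%R by exact: ler0n.
have ub : subunit (box c : R -> \bar R) by exact: subunit_itv_indic.
have mbox := lebesgue_measurable_borel ub.1.1.
have box_bspline x : box c x * bspline n.+1 x = bspline n.+1 x.
  rewrite boxE; case: (ltP `|x|%R (c / 2)%R) => xc; first by rewrite mul1e.
  by rewrite bspline_support// mule0.
(* Equality for the indicator of the support of the B-spline. *)
have boxG : \int[mu]_x (box c x * iter_convolution b n x) = 1.
  have := extremal _ (symmetrically_decreasing_of_box c).
  rewrite (integralM_ae mbox ub.1.2 GF0 wG.1.1 GFb).
  rewrite (integral_lebesgue_borel (nnborelM ub.1 wG.1.1)) => ->.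
  rewrite -wM.2 -(integral_lebesgue_borel wM.1.1).
  have [[hs0 _ _] [_ mhs _]] := rearrangementP mbox ub.1.2.
  apply: ge0_ae_eq_integral.
  - exact: measurableT.
  - exact: emeasurable_funM mhs (lebesgue_measurable_borel wM.1.1.1).
  - exact: lebesgue_measurable_borel wM.1.1.1.
  - by move=> x _; apply: mule_ge0; [exact: hs0|exact: wM.1.1.2].
  - by move=> x _; exact: wM.1.1.2.
  - apply: negligibleS (rearrangement_box mbox ub.1.2 (box_levels_box c0)) => x /=.
    by apply: contra_not => -> _; exact: box_bspline.
have [_] := concentrated_iter_convolution wb (box_mass_concentrated wG boxG).
have -> : (c / 2 - - (c / 2) = n.+1%:R)%R by rewrite /c; lra.
move=> /(_ (lexx _) j); rewrite -ltnS ltn_ord => /(_ isT)[a ba].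
have Fj : F j = EFin \o g j by rewrite /F inord_val.
have FI : mu.-negligible
    [set x : measurableTypeR R | F j x <> itv_indic `[a, (a + 1)%R] x].
  apply: negligibleS (negligibleU (Fb j) (unit_interval_mass_indic (wb j) ba)) => x /=.
  move=> Fx; have [Fbx|] := pselect (F j x = b j x); last by left.
  by right; rewrite -Fbx.
rewrite -Fj; apply: negligibleS
  (rearrangement_box (mF j) (F0 j) (box_levels_indicator (mF j) FI (F1 j))) => x /=.
by apply: contra_not => ->.
Qed.
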